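(* For every $s \in \{0, \tfrac12, 1, \tfrac32, \dots\}$ there is, up to isomorphism, a unique irreducible finite-dimensional complex (continuous) representation $\phi_s$ of $SU(2)$ of dimension $2s+1$. The induced Lie algebra representation $\Phi_s$ of $\mathfrak{su}(2)$ (extended complex-linearly to $\mathfrak{su}(2)_{\mathbb{C}}$), of the same dimension, is given in a suitable basis by $$\Phi_{s}(S_{3}) = \begin{pmatrix}s & 0 & \dots & 0 \\ 0 & s-1 & \dots & 0 \\ \vdots & \vdots & \ddots & \vdots \\ 0 & 0 & \dots & -s \end{pmatrix},$$ $$\Phi_{s}(S_{+}) = \begin{pmatrix}0 & b_{s-1} & 0 & \dots & 0 \\ 0 & 0 & b_{s-2} & \dots & 0 \\ \vdots & \vdots & \vdots & \ddots & \vdots \\ 0 & 0 & 0 & \dots & b_{-s} \\ 0 & 0 & 0 & \dots & 0 \end{pmatrix},\qquad \Phi_{s}(S_{-}) = \begin{pmatrix}0 & 0 & \dots & 0 & 0 \\ b_{s-1} & 0 & \dots & 0 & 0 \\ 0 & b_{s-2} & \dots & 0 & 0 \\ \vdots & \vdots & \ddots & \vdots & \vdots \\ 0 & 0 & \dots & b_{-s} & 0 \end{pmatrix},$$ where $b_{m} = \sqrt{s(s+1) - m(m+1)}$ for $m = -s, -s+1, \dots, s-1$.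
   Context: $\mathfrak{su}(2)$ is the real Lie algebra of traceless skew-Hermitian $2\times 2$ complex matrices, with basis $$X_{1} = \tfrac{1}{2}\begin{pmatrix}0 & -i \\ -i & 0 \end{pmatrix},\quad X_{2} = \tfrac{1}{2}\begin{pmatrix}0 & -1 \\ 1 & 0 \end{pmatrix},\quad X_{3} = \tfrac{1}{2}\begin{pmatrix}-i & 0 \\ 0 & i \end{pmatrix}.$$ The complexification $\mathfrak{su}(2)_{\mathbb{C}}$ is the complex span of $X_1,X_2,X_3$. The spin operators are $S_j = iX_j \in \mathfrak{su}(2)_{\mathbb{C}}$ for $j=1,2,3$, and the ladder operators are $S_{\pm} = S_1 \pm iS_2$; thus $\mathfrak{su}(2)_{\mathbb{C}}$ is the complex span of $S_+,S_-,S_3$. A representation $\phi: SU(2)\to GL(V)$ induces the Lie algebra representation $\Phi:\mathfrak{su}(2)\to\mathfrak{gl}(V)$, $\Phi(X) = \frac{d}{dt}\phi(e^{tX})\big|_{t=0}$, which is extended to $\mathfrak{su}(2)_{\mathbb{C}}$ by complex-linearity. *)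

(* Defs.v *)
From HB Require Import structures.
From mathcomp Require Import all_boot all_order all_algebra.
From mathcomp Require Import complex.
From mathcomp Require Import all_classical all_reals all_analysis.

Set Implicit Arguments.
Unset Strict Implicit.
Unset Printing Implicit Defensive.

Import Order.TTheory GRing.Theory Num.Theory.
Import numFieldNormedType.Exports.

Local Open Scope classical_set_scope.
Local Open Scope ring_scope.
Local Open Scope complex_scope.
Local Open Scope sesquilinear_scope.

(* The usual topology of the complex plane. MathComp-Analysis puts it on K^o
   for every numFieldType K; it is transferred here to the carrier R[i], so
   that complex matrices get the entrywise topology. *)
HB.instance Definition _ (R : realType) := NormedModule.copy R[i] (R[i]^o).

Section Groups_and_algebras.
Variable R : realType.

Definition mx22 (a b c d : R[i]) : 'M[R[i]]_2 :=
  \matrix_(i < 2, j < 2)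
    (if i == 0 then (if j == 0 then a else b)
               else (if j == 0 then c else d)).

Definition SU2 : set 'M[R[i]]_2 := [set g | g \is unitarymx /\ \det g = 1].

Definition su2 : set 'M[R[i]]_2 := [set X | X ^t* = - X /\ \tr X = 0].

Definition X1 : 'M[R[i]]_2 := 2^-1 *: mx22 0 (- 'i) (- 'i) 0.
Definition X2 : 'M[R[i]]_2 := 2^-1 *: mx22 0 (- 1) 1 0.
Definition X3 : 'M[R[i]]_2 := 2^-1 *: mx22 (- 'i) 0 0 'i.

Definition su2C : {vspace 'M[R[i]]_2} := <<[:: X1; X2; X3]>>%VS.

Definition S1 := 'i *: X1.
Definition S2 := 'i *: X2.
Definition S3 := 'i *: X3.
Definition Splus := S1 + 'i *: S2.
Definition Sminus := S1 - 'i *: S2.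

Definition expm (N : nat) (A : 'M[R[i]]_N) : 'M[R[i]]_N :=
  limn (series (fun k => (k`!%:R)^-1 *: A ^+ k)).

(* A finite-dimensional space carries a single Hausdorff vector space topology.
   That of End(V) is read off the matrices of endomorphisms in a fixed basis
   of V. *)
Definition end_mx (V : vectType R[i]) (f : 'End(V)) : 'M[R[i]]_(\dim {:V}) :=
  passmx.mxof (vbasis {:V}) (vbasis {:V}) f.

(* The values of rep_fun outside SU2 are irrelevant; on SU2 it takes
   values in GL(V) by rep_one and rep_mul. *)
Record SU2_rep := SU2Rep {
  rep_space :> vectType R[i];
  rep_fun : 'M[R[i]]_2 -> 'End(rep_space);
  rep_one : rep_fun 1%:M = \1%VF;
  rep_mul : forall g h, SU2 g -> SU2 h ->
    rep_fun (g *m h) = (rep_fun g \o rep_fun h)%VF;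
  rep_continuous : {within SU2, continuous (fun g => end_mx (rep_fun g))}
}.

Definition irreducible_rep (phi : SU2_rep) : Prop :=
  {:phi}%VS <> 0%VS /\
  forall U : {vspace phi},
    (forall g, SU2 g -> (rep_fun phi g @: U <= U)%VS) ->
    U = 0%VS \/ U = {:phi}%VS.

Definition isomorphic_rep (phi psi : SU2_rep) : Prop :=
  exists f : 'Hom(phi, psi),
    bijective f /\
    forall g, SU2 g -> (f \o rep_fun phi g)%VF = (rep_fun psi g \o f)%VF.

(* d/dt phi(e^{tX}) = D at t = 0, where t ranges over the reals *)
Definition is_differential_at (phi : SU2_rep) (X : 'M[R[i]]_2) (D : 'End(phi)) :
    Prop :=
  (fun t : R => (t^-1)%:C *:
     (end_mx (rep_fun phi (expm (t%:C *: X))) - end_mx (rep_fun phi 1%:M)))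
    @ 0^' --> end_mx D.

(* Phi is the complex-linear extension to su2C of the differential of phi.
   These conditions determine Phi on su2C, since su2 spans su2C; the values
   of Phi outside su2C are irrelevant. *)
Definition is_induced_rep (phi : SU2_rep) (Phi : 'M[R[i]]_2 -> 'End(phi)) :
    Prop :=
  [/\ forall (a : R[i]) X Y, X \in su2C -> Y \in su2C ->
        Phi (a *: X + Y) = a *: Phi X + Phi Y,
      forall X Y, X \in su2C -> Y \in su2C ->
        Phi (X *m Y - Y *m X)
          = (Phi X \o Phi Y)%VF - (Phi Y \o Phi X)%VF
    & forall X, su2 X -> is_differential_at X (Phi X)].

(* M is the matrix of f in the basis e in the column convention: the
   coordinates of f e_j form column j. (passmx.mxof yields the transpose.) *)
Definition has_matrix (V : vectType R[i]) (N : nat) (e : N.-tuple V)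
    (f : 'End(V)) (M : 'M[R[i]]_N) : Prop :=
  forall j : 'I_N, f (tnth e j) = \sum_(i < N) M i j *: tnth e i.

Definition spin_b (s m : R) : R := Num.sqrt (s * (s + 1) - m * (m + 1)).

(* Rows and columns are numbered from 0 to 2s, so that index i corresponds to
   the weight s - i. *)
Definition spin_S3 (s : R) (N : nat) : 'M[R[i]]_N :=
  \matrix_(i < N, j < N) (if i == j then (s - i%:R)%:C else 0).
Definition spin_Splus (s : R) (N : nat) : 'M[R[i]]_N :=
  \matrix_(i < N, j < N)
    (if j == i.+1 :> nat then (spin_b s (s - 1 - i%:R))%:C else 0).
Definition spin_Sminus (s : R) (N : nat) : 'M[R[i]]_N :=
  \matrix_(i < N, j < N)
    (if i == j.+1 :> nat then (spin_b s (s - 1 - j%:R))%:C else 0).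

End Groups_and_algebras.

(* Main.v *)
(* Existence: SU(2) acts on binary forms of degree n. A nonzero stable subspace
   is stable under a diagonal element with distinct eigenvalues, so it contains
   a monomial; applying a real rotation, it contains all of them.

   Differentiation: on a one-parameter subgroup exp(tX), a continuous
   representation rho is differentiable, because T(t) (P(d) - P(0)) =
   P(t + d) - P(t) for a primitive P of T(t) = rho(exp(tX)). Moreover rho is
   Lipschitz at 1: if rho is within 1/2 of 1 on a ball, an element whose first K
   powers lie in that ball is sent within 1/K of 1. Hence the derivative of rho
   along a curve through 1 depends only on the tangent vector. This makes the
   differential linear and compatible with conjugation, and differentiating the
   latter property yields the compatibility with brackets.

   Uniqueness and the matrices: in an irreducible representation of dimension
   n + 1, a vector of highest weight and its images under the powers of S_- span
   a subspace stable under the Lie algebra, hence under all exponentials by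
   uniqueness for linear differential equations, hence under SU(2); it is thus
   the whole space. The dimension forces the highest weight to be n/2, and
   rescaling the vectors gives the matrices of the statement. Two
   representations with the same such matrices are isomorphic, because a map
   that intertwines the generators intertwines the one-parameter groups. *)
Require Import Defs.
From HB Require Import structures.
From mathcomp Require Import all_boot all_order all_algebra.
From mathcomp Require Import complex.
From mathcomp Require Import all_classical all_reals all_analysis.
From mathcomp Require Import ring lra.

Set Implicit Arguments.
Unset Strict Implicit.
Unset Printing Implicit Defensive.

Import Order.TTheory GRing.Theory Num.Theory.
Import numFieldNormedType.Exports ComplexField.Normc passmx.

Local Open Scope classical_set_scope.
Local Open Scope ring_scope.
Local Open Scope complex_scope.
Local Open Scope sesquilinear_scope.

(** * Complex numbers and the l^1 norm of matrices *)

Section ComplexNumbers.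
Context {R : realType}.
Implicit Types z w : R[i].

Lemma complex_eq z w :
  complex.Re z = complex.Re w -> complex.Im z = complex.Im w -> z = w.
Proof. by move=> e1 e2; apply/eqP; rewrite eq_complex e1 e2 !eqxx. Qed.

Lemma cReD z w : complex.Re (z + w) = complex.Re z + complex.Re w.
Proof. by case: z w => [? ?] []. Qed.
Lemma cImD z w : complex.Im (z + w) = complex.Im z + complex.Im w.
Proof. by case: z w => [? ?] []. Qed.
Lemma cReN z : complex.Re (- z) = - complex.Re z.
Proof. by case: z. Qed.
Lemma cImN z : complex.Im (- z) = - complex.Im z.
Proof. by case: z. Qed.
Lemma cReJ z : complex.Re (conjc z) = complex.Re z.
Proof. by case: z. Qed.
Lemma cImJ z : complex.Im (conjc z) = - complex.Im z.
Proof. by case: z. Qed.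

Lemma cReB z w : complex.Re (z - w) = complex.Re z - complex.Re w.
Proof. by case: z w => [? ?] []. Qed.
Lemma cImB z w : complex.Im (z - w) = complex.Im z - complex.Im w.
Proof. by case: z w => [? ?] []. Qed.
Lemma cReM z w : complex.Re (z * w) =
  complex.Re z * complex.Re w - complex.Im z * complex.Im w.
Proof. by case: z w => [? ?] []. Qed.
Lemma cImM z w : complex.Im (z * w) =
  complex.Re z * complex.Im w + complex.Im z * complex.Re w.
Proof. by case: z w => [? ?] []. Qed.
Lemma Re_sum (I : finType) (F : I -> R[i]) :
  complex.Re (\sum_i F i) = \sum_i complex.Re (F i).
Proof. by elim/big_rec2: _ => // i x y _ <-; case: (F i) y => [? ?] []. Qed.
Lemma Im_sum (I : finType) (F : I -> R[i]) :
  complex.Im (\sum_i F i) = \sum_i complex.Im (F i).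
Proof. by elim/big_rec2: _ => // i x y _ <-; case: (F i) y => [? ?] []. Qed.

Definition cReImE := (cReD, cImD, cReN, cImN, cReM, cImM, cReJ, cImJ).

(** The adjoint [^t*] is built on the conjugation of numeric fields, while computations use [conjc].
    Both turn [z] into its squared modulus by multiplication, so they agree after cancelling [z]. *)
Lemma conjCE z : (Num.conj z) = conjc z.
Proof.
have [->|z0] := eqVneq z 0; first by rewrite !rmorph0.
by apply: (mulfI z0); rewrite -normCK sqr_normc.
Qed.

Lemma half_complex : (2^-1 : R[i]) = (2^-1 : R)%:C.
Proof. by rewrite fmorphV rmorph_nat. Qed.

Lemma normcD z w : normc (z + w) <= normc z + normc w.
Proof. exact: (@le_normcD R). Qed.

Lemma normc_opp z : normc (- z) = normc z.
Proof. exact: (@normcN R). Qed.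

Lemma normc_ge0 z : 0 <= normc z.
Proof. by case: z => a b; apply: sqrtr_ge0. Qed.

Lemma normc_real (x : R) : normc x%:C = `|x|.
Proof. by rewrite /= expr0n addr0 sqrtr_sqr. Qed.

Lemma normr_Re_le z : `|complex.Re z| <= normc z.
Proof.
case: z => a b /=; rewrite -sqrtr_sqr ler_sqrt ?lerDl ?addr_ge0// ?sqr_ge0//.
Qed.

Lemma normr_Im_le z : `|complex.Im z| <= normc z.
Proof.
case: z => a b /=; rewrite -sqrtr_sqr ler_sqrt ?lerDr ?addr_ge0// ?sqr_ge0//.
Qed.

Lemma normc_le_ReIm z : normc z <= `|complex.Re z| + `|complex.Im z|.
Proof.
case: z => a b /=; rewrite -[leRHS]ger0_norm ?addr_ge0// -sqrtr_sqr.
rewrite ler_sqrt ?sqr_ge0// sqrrD !real_normK ?num_real// lerD2r lerDl.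
by rewrite mulrn_wge0// mulr_ge0.
Qed.

Lemma normc_sum (I : finType) (F : I -> R[i]) :
  normc (\sum_i F i) <= \sum_i normc (F i).
Proof.
apply: (big_ind2 (fun z (x : R) => normc z <= x)) => //.
  by rewrite normc0.
by move=> x1 x2 y1 y2 le1 le2; apply: le_trans (normcD _ _) (lerD le1 le2).
Qed.

Lemma normc_sq z :
  normc z ^+ 2 = complex.Re z ^+ 2 + complex.Im z ^+ 2.
Proof. by case: z => x y /=; rewrite sqr_sqrtr// addr_ge0 ?sqr_ge0. Qed.

Lemma normr_normc z : `|z| = (normc z)%:C.
Proof. by rewrite normc_def; case: z. Qed.

(** Cauchy-Schwarz in the plane. The factor 2 is the one that comes from differentiating a sum of
    squares. *)
Lemma complex_dot_le z w :
  2 * (complex.Re z * complex.Re w + complex.Im z * complex.Im w) <=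
  2 * (normc z * normc w).
Proof.
rewrite ler_pM2l// -normcM; case: z w => [a b] [c d] /=.
apply: le_trans (ler_norm _) _; rewrite -sqrtr_sqr ler_wsqrtr//.
rewrite -subr_ge0 (_ : _ - _ = (a * d - b * c) ^+ 2) ?sqr_ge0//; ring.
Qed.

End ComplexNumbers.

Section MatrixNorm.
Context {R : realType}.

(* The l^1 norm is submultiplicative, which the entrywise maximum is not. *)
Definition mnorm m n (A : 'M[R[i]]_(m, n)) : R := \sum_i \sum_j normc (A i j).

Lemma mnorm_ge0 m n (A : 'M[R[i]]_(m, n)) : 0 <= mnorm A.
Proof. by apply: sumr_ge0 => i _; apply: sumr_ge0 => j _; apply: normc_ge0. Qed.

Lemma mnorm_row m n (A : 'M[R[i]]_(m, n)) i : \sum_j normc (A i j) <= mnorm A.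
Proof.
rewrite /mnorm (bigD1 i)//= lerDl.
by apply: sumr_ge0 => k _; apply: sumr_ge0 => l _; apply: normc_ge0.
Qed.

Lemma mnorm_entry m n (A : 'M[R[i]]_(m, n)) i j : normc (A i j) <= mnorm A.
Proof.
apply: le_trans (mnorm_row A i); rewrite (bigD1 j)//= lerDl.
by apply: sumr_ge0 => k _; apply: normc_ge0.
Qed.

Lemma mnorm0 m n : mnorm (0 : 'M[R[i]]_(m, n)) = 0.
Proof. by rewrite /mnorm big1// => i _; rewrite big1// => j _; rewrite mxE normc0. Qed.

Lemma mnorm_eq0 m n (A : 'M[R[i]]_(m, n)) : mnorm A <= 0 -> A = 0.
Proof.
move=> A0; apply/matrixP => i j; rewrite mxE; apply: eq0_normc.
by apply/eqP; rewrite eq_le normc_ge0 andbT (le_trans (mnorm_entry A i j)).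
Qed.

Lemma mnormD m n (A B : 'M[R[i]]_(m, n)) : mnorm (A + B) <= mnorm A + mnorm B.
Proof.
rewrite /mnorm -big_split; apply: ler_sum => i _; rewrite -big_split.
by apply: ler_sum => j _; rewrite mxE normcD.
Qed.

Lemma mnormZ m n c (A : 'M[R[i]]_(m, n)) : mnorm (c *: A) = normc c * mnorm A.
Proof.
rewrite /mnorm mulr_sumr; apply: eq_bigr => i _; rewrite mulr_sumr.
by apply: eq_bigr => j _; rewrite mxE normcM.
Qed.

Lemma mnormN m n (A : 'M[R[i]]_(m, n)) : mnorm (- A) = mnorm A.
Proof.
by apply: eq_bigr => i _; apply: eq_bigr => j _; rewrite mxE normc_opp.
Qed.

Lemma mnormB m n (A B : 'M[R[i]]_(m, n)) : mnorm (A - B) <= mnorm A + mnorm B.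
Proof. by apply: le_trans (mnormD _ _) _; rewrite mnormN. Qed.

Lemma mnormBC m n (A B : 'M[R[i]]_(m, n)) : mnorm (A - B) = mnorm (B - A).
Proof. by rewrite -mnormN opprB. Qed.

Lemma mnormM m n p (A : 'M[R[i]]_(m, n)) (B : 'M[R[i]]_(n, p)) :
  mnorm (A *m B) <= mnorm A * mnorm B.
Proof.
rewrite {1 2}/mnorm mulr_suml; apply: ler_sum => i _.
have -> : (\sum_j normc (A i j)) * mnorm B = \sum_j normc (A i j) * mnorm B.
  by rewrite mulr_suml.
apply: (@le_trans _ _ (\sum_k \sum_j normc (A i j) * normc (B j k))).
  apply: ler_sum => k _; rewrite mxE; apply: le_trans (normc_sum _) _.
  by apply: ler_sum => j _; rewrite normcM.
rewrite exchange_big; apply: ler_sum => j _; rewrite -mulr_sumr.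
by rewrite ler_wpM2l ?normc_ge0// mnorm_row.
Qed.

Lemma mnorm_sum m n (I : finType) (F : I -> 'M[R[i]]_(m, n)) :
  mnorm (\sum_i F i) <= \sum_i mnorm (F i).
Proof.
elim/big_ind2: _ => //; first by rewrite mnorm0.
by move=> x1 x2 y1 y2 le1 le2; apply: le_trans (mnormD _ _) (lerD le1 le2).
Qed.

(** If v A = 0, then c v = v (c - A) has norm at most half of c |v|, so v = 0. *)
Lemma mnorm_small_unit n (A : 'M[R[i]]_n) c :
  0 < c -> mnorm (A - c%:C%:M) <= c / 2 -> A \in unitmx.
Proof.
move=> c0 Ac; rewrite -row_free_unit -kermx_eq0; apply/eqP/row_matrixP => i.
rewrite row0; set v := row i _.
have vA : v *m A = 0 by apply/sub_kermxP; exact: row_sub.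
have : mnorm (c%:C *: v) <= mnorm v * (c / 2).
  rewrite -[c%:C *: v]subr0 -vA -mul_mx_scalar -mulmxBr.
  apply: le_trans (mnormM _ _) _.
  by rewrite ler_wpM2l ?mnorm_ge0// mnormBC.
rewrite mnormZ normc_real gtr0_norm// => h; apply: mnorm_eq0.
have := mnorm_ge0 v; nra.
Qed.

End MatrixNorm.

(** * Derivatives of curves of complex matrices *)

Section RealDerivative.
Context {R : realType}.

(** Without the quotient, the estimate makes sense at h = 0 too and carries over verbatim to matrix
    norms. *)
Lemma is_deriveP (f : R -> R) (t d : R) :
  is_derive t 1 f d <->
  forall e, 0 < e -> \forall h \near (0 : R),
    `|f (h + t) - f t - h * d| <= e * `|h|.
Proof.
split=> [[df fd] e e0|H].
- have : (fun h => h^-1 *: ((f \o shift t) (h *: (1:R)) - f t)) @ (0:R)^' --> d.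
    by rewrite -fd; exact: df.
  move=> /cvgrPdist_le /(_ e e0); rewrite near_withinE; apply: filterS => h /= D.
  have [->|h0] := eqVneq h 0.
    by rewrite add0r subrr mul0r subr0 normr0 mulr0.
  move: (D h0); rewrite /GRing.scale/= mulr1 => {}D.
  rewrite -ler_pdivrMr ?normr_gt0// -normfV -normrM.
  apply: le_trans D; rewrite distrC le_eqVlt; apply/orP; left; apply/eqP.
  by congr (`|_|); field.
- have C : (fun h => h^-1 *: ((f \o shift t) (h *: (1:R)) - f t)) @ (0:R)^' --> d.
    apply/cvgrPdist_le => e e0; rewrite near_withinE.
    apply: filterS (H e e0) => h /= D h0; move: D.
    rewrite -ler_pdivrMr ?normr_gt0// -normfV -normrM => D.
    apply: le_trans D; rewrite distrC le_eqVlt; apply/orP; left; apply/eqP.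
    by congr (`|_|); rewrite /GRing.scale/= mulr1; field.
  split; first by apply/cvg_ex; exists d.
  exact: cvg_lim C.
Qed.

End RealDerivative.

Section MatrixDerivative.
Context {R : realType}.

(** Real and imaginary parts are kept apart so that real calculus (product and chain rules, mean
    value theorem) applies to each entry. *)
Definition mderiv m n (F : R -> 'M[R[i]]_(m, n)) (t : R) (D : 'M[R[i]]_(m, n)) :=
  forall i j, is_derive t 1 (fun u => complex.Re (F u i j)) (complex.Re (D i j)) /\
              is_derive t 1 (fun u => complex.Im (F u i j)) (complex.Im (D i j)).

Lemma mderivP m n (F : R -> 'M[R[i]]_(m, n)) (t : R) (D : 'M[R[i]]_(m, n)) :
  mderiv F t D <->
  forall e, 0 < e -> \forall h \near (0 : R),
    mnorm (F (h + t) - F t - h%:C *: D) <= e * `|h|.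
Proof.
have E h i j : (complex.Re ((F (h + t) - F t - h%:C *: D) i j) =
   complex.Re (F (h + t) i j) - complex.Re (F t i j) - h * complex.Re (D i j)) *
  (complex.Im ((F (h + t) - F t - h%:C *: D) i j) =
   complex.Im (F (h + t) i j) - complex.Im (F t i j) - h * complex.Im (D i j)).
  by rewrite !mxE !cReB !cImB cReM cImM /= !mul0r subr0 addr0.
split=> [H e e0|H i j]; last first.
  split; apply/is_deriveP => e e0; apply: filterS (H e e0) => h; apply: le_trans.
    by rewrite -(E h i j).1 (le_trans (normr_Re_le _))// mnorm_entry.
  by rewrite -(E h i j).2 (le_trans (normr_Im_le _))// mnorm_entry.
(* One more than the number of entries, so that [k] is positive even for an empty matrix. The 2
   below shares the error between real and imaginary parts. *)
pose k : R := (m * n).+1%:R; have k0 : 0 < k by rewrite ltr0n.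
have e'0 : 0 < e / (2 * k) by rewrite divr_gt0// mulr_gt0.
have : \forall h \near (0 : R), forall ij : 'I_m * 'I_n,
    normc ((F (h + t) - F t - h%:C *: D) ij.1 ij.2) <= e / k * `|h|.
  apply: (@filter_forall _ _ (fun (ij : 'I_m * 'I_n) (h : R) =>
    normc ((F (h + t) - F t - h%:C *: D) ij.1 ij.2) <= e / k * `|h|) (nbhs (0 : R)) _ _).
  move=> [i j] /=; have [Re_d Im_d] := H i j.
  move/is_deriveP: Re_d => /(_ _ e'0) A; move/is_deriveP: Im_d => /(_ _ e'0) B.
  apply: filterS (filterI A B) => h [] {}A {}B.
  apply: le_trans (normc_le_ReIm _) _; rewrite (E h i j).1 (E h i j).2.
  apply: le_trans (lerD A B) _; rewrite -mulrDl.
  by apply: ler_wpM2r => //; rewrite le_eqVlt; apply/orP; left; apply/eqP; field; lra.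
apply: filterS => h B; rewrite /mnorm.
apply: (@le_trans _ _ (\sum_(i < m) \sum_(j < n) e / k * `|h|)).
  by apply: ler_sum => i _; apply: ler_sum => j _; exact: (B (i, j)).
rewrite !sumr_const !card_ord -mulrnA mulnC -mulr_natr.
rewrite mulrAC ler_wpM2r// mulrAC -mulrA ler_piMr ?ltW//.
by rewrite ltr_pdivrMr// mul1r ltr_nat.
Qed.

Lemma mderiv_eq m n (F : R -> 'M[R[i]]_(m, n)) t D D' :
  mderiv F t D -> D = D' -> mderiv F t D'.
Proof. by move=> ? <-. Qed.

Lemma mderiv_near m n (F G : R -> 'M[R[i]]_(m, n)) t D :
  (\forall u \near t, F u = G u) -> mderiv F t D -> mderiv G t D.
Proof.
move=> FG FD i j; have [A B] := FD i j.
split.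
  apply: near_eq_is_derive A.
  by apply: filterS FG => u ->.
apply: near_eq_is_derive B.
by apply: filterS FG => u ->.
Qed.

Lemma mderiv_ext m n (F G : R -> 'M[R[i]]_(m, n)) t D :
  (forall u, F u = G u) -> mderiv F t D -> mderiv G t D.
Proof. by move=> FG FD; apply: mderiv_near FD; near=> u; exact: FG.
Unshelve. all: by end_near. Qed.

Lemma mderiv_unique m n (F : R -> 'M[R[i]]_(m, n)) t D D' :
  mderiv F t D -> mderiv F t D' -> D = D'.
Proof.
move=> H H'; apply/matrixP => i j.
have [[_ A] [_ B]] := H i j; have [[_ A'] [_ B']] := H' i j.
by apply/eqP; rewrite eq_complex -A -A' -B -B' !eqxx.
Qed.

Lemma mderiv_cst m n (A : 'M[R[i]]_(m, n)) t : mderiv (fun=> A) t 0.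
Proof. by move=> i j; rewrite mxE; split; apply: is_derive_cst. Qed.

Lemma mderivD m n (F G : R -> 'M[R[i]]_(m, n)) t D E :
  mderiv F t D -> mderiv G t E -> mderiv (fun u => F u + G u) t (D + E).
Proof.
move=> FD GE i j; have [A B] := FD i j; have [A' B'] := GE i j.
split; [rewrite (_ : (fun u => _) = (fun u => complex.Re (F u i j)) \+
    (fun u => complex.Re (G u i j)))|rewrite (_ : (fun u => _) =
    (fun u => complex.Im (F u i j)) \+ (fun u => complex.Im (G u i j)))].
- by rewrite mxE cReD; exact: is_deriveD.
- by apply/funext => u; rewrite mxE cReD.
- by rewrite mxE cImD; exact: is_deriveD.
- by apply/funext => u; rewrite mxE cImD.
Qed.

Lemma mderivM m n p (F : R -> 'M[R[i]]_(m, n)) (G : R -> 'M[R[i]]_(n, p)) t D E :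
  mderiv F t D -> mderiv G t E ->
  mderiv (fun u => F u *m G u) t (D *m G t + F t *m E).
Proof.
move=> FD GE i j; split.
- have := @is_derive_sum R R R n (fun k =>
    (fun u => complex.Re (F u i k)) * (fun u => complex.Re (G u k j))
    - (fun u => complex.Im (F u i k)) * (fun u => complex.Im (G u k j))) t 1 _
    (fun k => is_deriveB (is_deriveM (FD i k).1 (GE k j).1)
                         (is_deriveM (FD i k).2 (GE k j).2)).
  rewrite (_ : \sum_(k < n) _ = fun u => complex.Re ((F u *m G u) i j)); last first.
    by apply/funext => u; rewrite mxE Re_sum fct_sumE; apply: eq_bigr => k _; rewrite cReM.
  rewrite (_ : \sum_(k < n) _ = complex.Re ((D *m G t + F t *m E) i j))//.
  rewrite !mxE -big_split /= Re_sum; apply: eq_bigr => k _ /=.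
  rewrite /GRing.scale/=.
  case: (F t i k) (D i k) (G t k j) (E k j) => [? ?] [? ?] [? ?] [? ?] /=; ring.
- have := @is_derive_sum R R R n (fun k =>
    (fun u => complex.Re (F u i k)) * (fun u => complex.Im (G u k j))
    + (fun u => complex.Im (F u i k)) * (fun u => complex.Re (G u k j))) t 1 _
    (fun k => is_deriveD (is_deriveM (FD i k).1 (GE k j).2)
                         (is_deriveM (FD i k).2 (GE k j).1)).
  rewrite (_ : \sum_(k < n) _ = fun u => complex.Im ((F u *m G u) i j)); last first.
    by apply/funext => u; rewrite mxE Im_sum fct_sumE; apply: eq_bigr => k _; rewrite cImM.
  rewrite (_ : \sum_(k < n) _ = complex.Im ((D *m G t + F t *m E) i j))//.
  rewrite !mxE -big_split /= Im_sum; apply: eq_bigr => k _ /=.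
  rewrite /GRing.scale/=.
  case: (F t i k) (D i k) (G t k j) (E k j) => [? ?] [? ?] [? ?] [? ?] /=; ring.
Qed.

Lemma mderivMl m n p (A : 'M[R[i]]_(m, n)) (G : R -> 'M[R[i]]_(n, p)) t E :
  mderiv G t E -> mderiv (fun u => A *m G u) t (A *m E).
Proof.
by move=> GE; apply: mderiv_eq (mderivM (mderiv_cst A t) GE) _; rewrite mul0mx add0r.
Qed.

Lemma mderivMr m n p (F : R -> 'M[R[i]]_(m, n)) (B : 'M[R[i]]_(n, p)) t D :
  mderiv F t D -> mderiv (fun u => F u *m B) t (D *m B).
Proof.
by move=> FD; apply: mderiv_eq (mderivM FD (mderiv_cst B t)) _; rewrite mulmx0 addr0.
Qed.

Lemma mderivN m n (F : R -> 'M[R[i]]_(m, n)) t D :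
  mderiv F t D -> mderiv (fun u => - F u) t (- D).
Proof.
move=> FD; apply: (@mderiv_ext _ _ (fun u => - 1%:M *m F u)).
  by move=> u; rewrite mulNmx mul1mx.
by apply: mderiv_eq (mderivMl _ FD) _; rewrite mulNmx mul1mx.
Qed.

Lemma mderivB m n (F G : R -> 'M[R[i]]_(m, n)) t D E :
  mderiv F t D -> mderiv G t E -> mderiv (fun u => F u - G u) t (D - E).
Proof. by move=> FD GE; apply: mderivD FD (mderivN GE). Qed.

Lemma mderiv_affine m n (F : R -> 'M[R[i]]_(m, n)) a b t D :
  mderiv F (a * t + b) D -> mderiv (fun u => F (a * u + b)) t (a%:C *: D).
Proof.
move=> FD i j; have [A B] := FD i j.
have aff : is_derive t 1 (fun u : R => a * u + b) a.
  have A1 := @is_deriveZ R R R (@id R) a t 1 1 (@is_derive_id _ _ _ _).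
  have A2 := @is_derive_cst R R R b t 1.
  by have A12 := is_deriveD A1 A2; rewrite addr0 /GRing.scale/= mulr1 in A12.
rewrite mxE cReM cImM /= !mul0r subr0 addr0 ![a * _]mulrC.
split.
  exact: (@is_derive1_comp _ (fun u => complex.Re (F u i j)) (fun u => a * u + b) t _ _ A aff).
exact: (@is_derive1_comp _ (fun u => complex.Im (F u i j)) (fun u => a * u + b) t _ _ B aff).
Qed.

Lemma mderiv_shift m n (F : R -> 'M[R[i]]_(m, n)) b t D :
  mderiv F (t + b) D -> mderiv (fun u => F (u + b)) t D.
Proof.
move=> FD; have := @mderiv_affine _ _ F 1 b t D.
by rewrite mul1r scale1r => /(_ FD); apply: mderiv_ext => u; rewrite mul1r.
Qed.

Lemma mderiv_opp m n (F : R -> 'M[R[i]]_(m, n)) t D :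
  mderiv F (- t) D -> mderiv (fun u => F (- u)) t (- D).
Proof.
move=> FD; have := @mderiv_affine _ _ F (-1) 0 t D.
rewrite mulN1r addr0 => /(_ FD) H; apply: mderiv_eq (mderiv_ext _ H) _.
  by move=> u; rewrite mulN1r addr0.
by rewrite rmorphN1 scaleN1r.
Qed.

Lemma mderiv_scale m n (f : R -> R) df (A : 'M[R[i]]_(m, n)) (t : R) :
  is_derive t 1 f df -> mderiv (fun u => (f u)%:C *: A) t (df%:C *: A).
Proof.
move=> fd i j.
have E (x : R) : (complex.Re ((x%:C *: A) i j) = complex.Re (A i j) * x) *
                 (complex.Im ((x%:C *: A) i j) = complex.Im (A i j) * x).
  by rewrite mxE !cReImE /= !mul0r subr0 addr0 ![_ * x]mulrC.
rewrite (E df).1 (E df).2.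
have -> : (fun u => complex.Re (((f u)%:C *: A) i j)) = complex.Re (A i j) \*: f.
  by apply/funext => u; rewrite (E (f u)).1.
have -> : (fun u => complex.Im (((f u)%:C *: A) i j)) = complex.Im (A i j) \*: f.
  by apply/funext => u; rewrite (E (f u)).2.
by split; apply: is_deriveZ.
Qed.

Lemma mderiv_continuous m n (F : R -> 'M[R[i]]_(m, n)) t D e :
  mderiv F t D -> 0 < e -> \forall h \near (0 : R), mnorm (F (h + t) - F t) <= e.
Proof.
move=> /mderivP /(_ 1 ltr01) FD e0.
have k0 : 0 < 1 + mnorm D by rewrite ltr_pwDl ?mnorm_ge0.
have : \forall h \near (0 : R), `|h| <= e / (1 + mnorm D).
  apply/nbhs_ballP; exists (e / (1 + mnorm D)); first exact: divr_gt0.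
  by move=> y; rewrite /ball/= sub0r normrN => /ltW.
move=> H; apply: filterS (filterI FD H) => h [Fh hk].
rewrite -[F (h + t) - F t](subrK (h%:C *: D)) (le_trans (mnormD _ _))//.
rewrite mnormZ normc_real (le_trans (lerD Fh (lexx _)))// mul1r.
rewrite -[X in X + _ <= _]mulr1 -mulrDr.
by rewrite -ler_pdivlMr.
Qed.

Lemma is_derive0_cst (f : R -> R) (a b : R) : a <= b ->
  (forall x : R, x \in `[a, b] -> is_derive x 1 f 0) -> f a = f b.
Proof.
move=> ab H.
have D0 (x : R) : x \in `]a, b[ -> is_derive x 1 f (cst 0 x).
  by move=> xab; apply: H; apply: subset_itv_oo_cc.
have cf : {within `[a, b], continuous f}.
  by apply: derivable_within_continuous => x xab; have [] := H x xab.
by have [c _ /eqP] := MVT_segment ab D0 cf; rewrite mul0r subr_eq0 => /eqP.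
Qed.

Lemma mderiv0_cst m n (F : R -> 'M[R[i]]_(m, n)) (a b : R) : a <= b ->
  (forall x : R, x \in `[a, b] -> mderiv F x 0) -> F a = F b.
Proof.
move=> ab H; apply/matrixP => i j; apply/eqP; rewrite eq_complex.
apply/andP; split; apply/eqP.
  apply: (@is_derive0_cst (fun u => complex.Re (F u i j)) a b ab) => x xab.
  by have := (H x xab i j).1; rewrite mxE.
apply: (@is_derive0_cst (fun u => complex.Im (F u i j)) a b ab) => x xab.
by have := (H x xab i j).2; rewrite mxE.
Qed.

Lemma mderiv0_constant m n (F : R -> 'M[R[i]]_(m, n)) t :
  (forall x, mderiv F x 0) -> F t = F 0.
Proof.
move=> H; have [t0|/ltW t0] := leP t 0.
  by apply: mderiv0_cst.
by apply/esym; apply: mderiv0_cst.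
Qed.

End MatrixDerivative.

(** * One-parameter groups and linear differential equations *)

Section OneParameter.
Context {R : realType}.

(** The integral from [a] is differentiated by the fundamental theorem of calculus on [a, x + 1],
    where x is interior; hence the restriction to x > a. *)
Lemma primitive_exists (f : R -> R) (a : R) : continuous f ->
  exists F : R -> R, forall x, a < x -> is_derive x 1 F (f x).
Proof.
move=> cf; exists (fun y => \int[lebesgue_measure]_(t in `[a, y]) f t) => x ax.
have xu : x < x + 1 by rewrite ltrDl.
have fi : lebesgue_measure.-integrable `[a, x + 1] (EFin \o f).
  apply: continuous_compact_integrable; first exact: segment_compact.
  exact: continuous_subspaceT.
have [dF eF] := continuous_FTC1_closed xu fi ax (cf x).
by apply: DeriveDef; [exact: dF|rewrite -derive1E].
Qed.

Definition mcontinuous m n (F : R -> 'M[R[i]]_(m, n)) := forall t e, 0 < e ->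
  \forall h \near (0 : R), mnorm (F (h + t) - F t) <= e.

Lemma mcontinuous_entry m n (F : R -> 'M[R[i]]_(m, n)) i j : mcontinuous F ->
  continuous (fun t => complex.Re (F t i j)) /\
  continuous (fun t => complex.Im (F t i j)).
Proof.
move=> cF.
have H t e : 0 < e -> exists2 d : R, 0 < d &
    forall y, ball t d y -> normc (F t i j - F y i j) <= e.
  move=> e0; have /nbhs_ballP[d /= d0 Hd] := cF t e e0; exists d => // y ty.
  have := Hd (y - t); rewrite /ball/= sub0r opprB => /(_ ty); rewrite subrK.
  rewrite mnormBC; apply: le_trans; apply: le_trans (mnorm_entry _ i j).
  by rewrite !mxE.
split=> t; apply/cvgrPdist_le => e e0; apply/nbhs_ballP;
  have [d d0 Hd] := H t e e0; exists d => // y ty; apply: le_trans (Hd y ty).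
  by rewrite -cReB normr_Re_le.
by rewrite -cImB normr_Im_le.
Qed.

Lemma mprimitive_exists m n (F : R -> 'M[R[i]]_(m, n)) (a : R) :
  mcontinuous F -> exists G, forall x, a < x -> mderiv G x (F x).
Proof.
move=> cF.
have /choice[G HG] : forall ij : 'I_m * 'I_n, exists G : (R -> R) * (R -> R),
    forall x, a < x -> is_derive x 1 G.1 (complex.Re (F x ij.1 ij.2)) /\
                       is_derive x 1 G.2 (complex.Im (F x ij.1 ij.2)).
  move=> [i j]; have [cR cI] := mcontinuous_entry i j cF.
  have [G1 H1] := primitive_exists a cR; have [G2 H2] := primitive_exists a cI.
  by exists (G1, G2) => x ax; split; [apply: H1|apply: H2].
pose M x : 'M[R[i]]_(m, n) := \matrix_(i, j) ((G (i, j)).1 x +i* (G (i, j)).2 x).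
exists M => x ax i j; have [A B] := HG (i, j) x ax.
have E1 : (fun u => complex.Re (M u i j)) = (G (i, j)).1.
  by apply/funext => u; rewrite mxE.
have E2 : (fun u => complex.Im (M u i j)) = (G (i, j)).2.
  by apply/funext => u; rewrite mxE.
by rewrite E1 E2; split; [exact: A|exact: B].
Qed.

Definition one_param N (T : R -> 'M[R[i]]_N) :=
  [/\ T 0 = 1%:M, forall s t, T (s + t) = T s *m T t & mcontinuous T].

Lemma one_param_continuous N (T : R -> 'M[R[i]]_N) :
  (forall s t, T (s + t) = T s *m T t) ->
  (forall e, 0 < e -> \forall h \near (0 : R), mnorm (T h - 1%:M) <= e) ->
  mcontinuous T.
Proof.
move=> TD T0 t e e0.
have d0 : 0 < mnorm (T t) + 1 by rewrite ltr_wpDl ?mnorm_ge0.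
apply: filterS (T0 (e / (mnorm (T t) + 1)) (divr_gt0 e0 d0)) => h Th.
rewrite TD -{2}[T t]mul1mx -mulmxBl (le_trans (mnormM _ _))//.
apply: (@le_trans _ _ (e / (mnorm (T t) + 1) * (mnorm (T t) + 1))).
  by rewrite ler_pM ?mnorm_ge0// lerDl.
by rewrite divfK// gt_eqF.
Qed.

(* For a primitive [P] of [T], [T t *m (P d - P 0) = P (t + d) - P t], and
   [P d - P 0] is invertible for small [d]. *)
Lemma one_param_deriv0 N (T : R -> 'M[R[i]]_N) : one_param T ->
  exists A, mderiv T 0 A.
Proof.
move=> [T0 TD cT].
(* The base point -2 leaves room on the left of 0: [P] is evaluated below at points greater than
   -1. *)
have [P HP] := mprimitive_exists (-2) cT.
have E t d : -1 < t -> 0 <= d -> T t *m (P d - P 0) = P (d + t) - P t.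
  move=> t1 d0.
  (* The function P(s + t) - T(t) P(s) of s has derivative T(s + t) - T(t) T(s) = 0. *)
  have := @mderiv0_cst R _ _ (fun s => P (s + t) - T t *m P s) 0 d d0.
  rewrite add0r => H; rewrite mulmxBr.
  have {H} : P t - T t *m P 0 = P (d + t) - T t *m P d.
    apply: H => x; rewrite in_itv/= => /andP[x0 _].
    rewrite (_ : 0 = T (x + t) - T t *m T x); last first.
      by rewrite [x + t]addrC TD subrr.
    apply: mderivB; first by apply: mderiv_shift; apply: HP; lra.
    by apply: mderivMl; apply: HP; lra.
  move=> H; apply: (addrI (P t)).
  by rewrite addrCA H addrCA subrr addr0 [RHS]addrC subrK.
(* As P'(0) = T(0) = 1, for small d the difference P(d) - P(0) is within d/2 of the scalar matrix
   d. *)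
have [d [d0 uJ]] : exists d : R, 0 < d /\ P d - P 0 \in unitmx.
  have /mderivP/(_ 2^-1) : mderiv P 0 1%:M by rewrite -T0; apply: HP; lra.
  move=> /(_ ltac:(by rewrite invr_gt0)) /nbhs_ballP[e /= e0 He].
  exists (e / 2); split; first by rewrite divr_gt0.
  apply: (@mnorm_small_unit _ _ _ (e / 2)); first by rewrite divr_gt0.
  have := He (e / 2); rewrite addr0 scalemx1 /ball/= sub0r normrN.
  rewrite gtr0_norm ?divr_gt0// => Hd; rewrite [leRHS]mulrC; apply: Hd; lra.
exists ((T (0 + d) - T 0) *m invmx (P d - P 0)).
apply: (@mderiv_near _ _ _ (fun u => (P (u + d) - P u) *m invmx (P d - P 0))).
  have : \forall u \near (0:R), -1 < u by apply: lt_nbhsr; lra.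
  apply: filterS => u u1.
  by rewrite [u + d]addrC -E ?mulmxK// ltW.
apply: mderivMr; apply: mderivB; last by apply: HP; lra.
by apply: mderiv_shift; apply: HP; lra.
Qed.

Lemma one_param_deriv N (T : R -> 'M[R[i]]_N) A t : one_param T ->
  mderiv T 0 A -> mderiv T t (T t *m A) /\ mderiv T t (A *m T t).
Proof.
move=> [_ TD _] TA; split.
  apply: (@mderiv_ext _ _ _ (fun u => T t *m T (u - t))).
    by move=> u; rewrite -TD addrC subrK.
  by apply: mderivMl; apply: mderiv_shift; rewrite subrr.
apply: (@mderiv_ext _ _ _ (fun u => T (u - t) *m T t)).
  by move=> u; rewrite -TD subrK.
by apply: mderivMr; apply: mderiv_shift; rewrite subrr.
Qed.

(** The curve T(-u) F S(u) has derivative T(-u) (F B - A F) S(u) = 0, so it keeps its initial value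
    F. *)
Lemma one_param_intertwine m n (T : R -> 'M[R[i]]_m) (S : R -> 'M[R[i]]_n) A B
    (F : 'M[R[i]]_(m, n)) t :
  one_param T -> one_param S -> mderiv T 0 A -> mderiv S 0 B ->
  A *m F = F *m B -> T t *m F = F *m S t.
Proof.
move=> oT oS TA SB AF; have [T0 TD _] := oT; have [S0 SD _] := oS.
have E : T (- t) *m F *m S t = F.
  rewrite (@mderiv0_constant R _ _ (fun u => T (- u) *m F *m S u) t).
    by rewrite oppr0 T0 S0 mul1mx mulmx1.
  move=> x; rewrite (_ : 0 = (- (T (- x) *m A)) *m F *m S x
      + T (- x) *m F *m (B *m S x)); last first.
    by rewrite !mulNmx -!mulmxA [F *m (B *m _)]mulmxA -AF -!mulmxA addNr.
  apply: mderivM; last by have [] := one_param_deriv x oS SB.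
  apply: mderivMr; apply: mderiv_opp.
  by have [] := one_param_deriv (- x) oT TA.
by rewrite -{1}E !mulmxA -TD subrr T0 mul1mx.
Qed.

(** The product of u with exp(-K y) has a nonpositive derivative and starts at 0. *)
Lemma gronwall0 (u du : R -> R) K t :
  (forall x : R, is_derive x 1 u (du x)) -> (forall x, du x <= K * u x) ->
  u 0 = 0 -> 0 <= t -> u t <= 0.
Proof.
move=> Hu Ku u0 t0.
have De (x : R) : is_derive x 1 (fun y => expR (- K * y)) (- K * expR (- K * x)).
  have A1 := @is_deriveZ R R R (@id R) (- K) x 1 1 (@is_derive_id _ _ _ _).
  have := @is_derive1_comp _ expR (fun y => - K * y) x _ _ (is_derive_expR _) A1.
  by rewrite /GRing.scale/= mulr1 mulrC.
pose g (y : R) := expR (- K * y) * u y.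
have Dg (x : R) : is_derive x 1 g (expR (- K * x) * (du x - K * u x)).
  apply: (is_derive_eq (is_deriveM (De x) (Hu x))).
  rewrite /GRing.scale/=; ring.
have cg : {within `[0, t], continuous g}.
  by apply: derivable_within_continuous => x _; have [] := Dg x.
have [c _] := MVT_segment t0 (fun x _ => Dg x) cg.
rewrite /g u0 !mulr0 !subr0 => gt.
have : expR (- K * t) * u t <= 0.
  rewrite gt mulr_le0_ge0// pmulr_rle0 ?expR_gt0//.
  by rewrite subr_le0.
by rewrite pmulr_rle0 ?expR_gt0.
Qed.

(** Energy estimate: the sum [u] of the squared moduli of the entries of H satisfies u' <= K u with
    u(0) = 0, so it vanishes by [gronwall0]. *)
Lemma mderiv_linear_ode0 m n (H : R -> 'M[R[i]]_(m, n)) C t :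
  (forall x, mderiv H x (H x *m C)) -> H 0 = 0 -> H t = 0.
Proof.
(* Reversing time replaces C by -C. *)
wlog t0 : H C t / 0 <= t.
  move=> W HC H0; have [/ltW t0|t0] := ltP 0 t; first exact: (W H C).
  rewrite -[t]opprK; apply: (W (fun u => H (- u)) (- C)); last by rewrite oppr0.
    by rewrite oppr_ge0.
  by move=> x; rewrite mulmxN; apply: mderiv_opp; apply: HC.
move=> HC H0.
pose re (x : R) (p : 'I_m * 'I_n) := complex.Re (H x p.1 p.2).
pose im (x : R) (p : 'I_m * 'I_n) := complex.Im (H x p.1 p.2).
pose u (x : R) := \sum_p (re x p ^+ 2 + im x p ^+ 2).
pose dre (x : R) (p : 'I_m * 'I_n) := complex.Re ((H x *m C) p.1 p.2).
pose dim (x : R) (p : 'I_m * 'I_n) := complex.Im ((H x *m C) p.1 p.2).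
pose du (x : R) := \sum_p (2 * (re x p * dre x p + im x p * dim x p)).
have Du (x : R) : is_derive x 1 u (du x).
  (* The derivative rule for sums is indexed by ordinals, so the pairs of indices are enumerated. *)
  have E : u = \sum_(k < #|{: 'I_m * 'I_n}|)
     ((fun y => re y (enum_val k)) * (fun y => re y (enum_val k)) +
      (fun y => im y (enum_val k)) * (fun y => im y (enum_val k))).
    apply/funext => y; rewrite fct_sumE /u (reindex_onto enum_val enum_rank) /=.
      by apply: eq_big => [k|k _]; rewrite ?enum_valK ?eqxx// !expr2.
    by move=> p _; rewrite enum_rankK.
  rewrite E; have Ds := @is_derive_sum R R R _ _ x 1 _
    (fun k : 'I_#|{: 'I_m * 'I_n}| =>
    is_deriveD (is_deriveM (HC x (enum_val k).1 (enum_val k).2).1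
                           (HC x (enum_val k).1 (enum_val k).2).1)
               (is_deriveM (HC x (enum_val k).1 (enum_val k).2).2
                           (HC x (enum_val k).1 (enum_val k).2).2)).
  apply: (is_derive_eq Ds).
  rewrite /du [RHS](reindex_onto enum_val enum_rank) /=; last by move=> p _; rewrite enum_rankK.
  apply: eq_big => [k|k _]; rewrite ?enum_valK ?eqxx//.
  rewrite /GRing.scale/= -/(re x (enum_val k)) -/(im x _) -/(dre x _) -/(dim x _); ring.
have normE (x : R) (p : 'I_m * 'I_n) : normc (H x p.1 p.2) ^+ 2 = re x p ^+ 2 + im x p ^+ 2.
  rewrite /re /im; case: (H x p.1 p.2) => a b /=; rewrite sqr_sqrtr//.
  by rewrite addr_ge0 ?sqr_ge0.
have mnE (x : R) : mnorm (H x) = \sum_p normc (H x p.1 p.2).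
  by rewrite /mnorm pair_big.
have u0 : u 0 = 0.
  by rewrite /u big1// => p _; rewrite /re /im H0 !mxE expr0n addr0.
(* Cauchy-Schwarz for the l^1 norm, from 2 a b <= a^2 + b^2 summed over all pairs of entries. *)
have CS (x : R) : mnorm (H x) ^+ 2 <= #|{: 'I_m * 'I_n}|%:R * u x.
  rewrite expr2 !mnE mulr_suml.
  apply: (@le_trans _ _ (\sum_p \sum_q
     (normc (H x p.1 p.2) ^+ 2 / 2 + normc (H x q.1 q.2) ^+ 2 / 2))).
    apply: ler_sum => p _; rewrite mulr_sumr; apply: ler_sum => q _.
    have := sqr_ge0 (normc (H x p.1 p.2) - normc (H x q.1 q.2)); nra.
  under eq_bigr do rewrite big_split /= sumr_const -mulr_suml.
  rewrite big_split /= sumr_const sumrMnl -mulr_suml -mulrnDl -splitr.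
  by rewrite (eq_bigr _ (fun p _ => normE x p)) -[leLHS]mulr_natl.
have Kdu (x : R) : du x <= (2 * mnorm C * #|{: 'I_m * 'I_n}|%:R) * u x.
  rewrite -mulrA; apply: le_trans (ler_wpM2l _ (CS x)); last first.
    by rewrite mulr_ge0 ?mnorm_ge0.
  rewrite /du -mulrA.
  apply: (@le_trans _ _ (\sum_p 2 * (mnorm (H x) * normc ((H x *m C) p.1 p.2)))).
    apply: ler_sum => p _.
    apply: (@le_trans _ _ (2 * (normc (H x p.1 p.2) * normc ((H x *m C) p.1 p.2)))).
      exact: complex_dot_le.
    by rewrite ler_pM2l// ler_wpM2r ?normc_ge0// mnorm_entry.
  rewrite -!mulr_sumr ler_pM2l//.
  have -> : \sum_p normc ((H x *m C) p.1 p.2) = mnorm (H x *m C).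
    by rewrite /mnorm pair_big.
  have := mnormM (H x) C; have := mnorm_ge0 (H x); nra.
have := gronwall0 Du Kdu u0 t0.
have Ht p : 0 <= re t p ^+ 2 + im t p ^+ 2 by rewrite addr_ge0 ?sqr_ge0.
move=> ut; have /eqP : u t = 0 by apply/eqP; rewrite eq_le ut sumr_ge0.
rewrite psumr_eq0// => /allP Hz; apply/matrixP => i j; rewrite mxE.
have := Hz (i, j); rewrite mem_index_enum => /(_ isT) /=.
rewrite -normE sqrf_eq0 => /eqP; exact: eq0_normc.
Qed.

End OneParameter.

(** * SU(2) and the exponential map *)

Section SU2.
Context {R : realType}.
Implicit Types (g h X Y : 'M[R[i]]_2).

Lemma mx22E (a b c d : R[i]) :
  (mx22 a b c d 0 0 = a) * (mx22 a b c d 0 1 = b) *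
  ((mx22 a b c d 1 0 = c) * (mx22 a b c d 1 1 = d)).
Proof. by rewrite !mxE. Qed.

Lemma mx22_ext g h : g 0 0 = h 0 0 -> g 0 1 = h 0 1 -> g 1 0 = h 1 0 ->
  g 1 1 = h 1 1 -> g = h.
Proof.
move=> h00 h01 h10 h11; apply/matrixP => i j.
have I2 (k : 'I_2) : k = 0 \/ k = 1.
  by case: k => -[|[|//]] lt_k; [left|right]; apply/val_inj.
by case: (I2 i) (I2 j) => -> [] ->.
Qed.

Lemma mx22_eta g : g = mx22 (g 0 0) (g 0 1) (g 1 0) (g 1 1).
Proof. by apply: mx22_ext; rewrite mx22E. Qed.

Lemma mul_mx22E g h :
  ((g *m h) 0 0 = g 0 0 * h 0 0 + g 0 1 * h 1 0) *
  ((g *m h) 0 1 = g 0 0 * h 0 1 + g 0 1 * h 1 1) *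
  (((g *m h) 1 0 = g 1 0 * h 0 0 + g 1 1 * h 1 0) *
  ((g *m h) 1 1 = g 1 0 * h 0 1 + g 1 1 * h 1 1)).
Proof.
have lift01 : lift ord0 ord0 = 1 :> 'I_2 by apply/val_inj.
by rewrite !mxE !big_ord_recl !big_ord0 !addr0 !lift01.
Qed.

Lemma mul_mx22 (a b c d a' b' c' d' : R[i]) :
  mx22 a b c d *m mx22 a' b' c' d' =
  mx22 (a * a' + b * c') (a * b' + b * d') (c * a' + d * c') (c * b' + d * d').
Proof. by apply: mx22_ext; rewrite mul_mx22E !mx22E. Qed.

Lemma mxtrace2 X : \tr X = X 0 0 + X 1 1.
Proof.
have lift01 : lift ord0 ord0 = 1 :> 'I_2 by apply/val_inj.
by rewrite /mxtrace !big_ord_recl big_ord0 addr0 lift01.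
Qed.

Lemma det_mx22 g : \det g = g 0 0 * g 1 1 - g 0 1 * g 1 0.
Proof.
have lift01 : lift ord0 ord0 = 1 :> 'I_2 by apply/val_inj.
have lift10 : lift 1 ord0 = 0 :> 'I_2 by apply/val_inj.
rewrite (expand_det_row _ 0) !big_ord_recl big_ord0 addr0 lift01.
rewrite /cofactor !det_mx11 !mxE /= !lift01 !lift10 add0n expr0 mul1r.
by rewrite expr1 mulN1r mulrN.
Qed.

Lemma adj_mx22 g : g *m mx22 (g 1 1) (- g 0 1) (- g 1 0) (g 0 0) = (\det g)%:M.
Proof.
by apply: mx22_ext; rewrite mul_mx22E !mx22E det_mx22 !mxE /=; ring.
Qed.

(** For determinant 1 the adjugate is the inverse, and so is the conjugate transpose of a unitary
    matrix; comparing their entries gives the shape of g. *)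
Lemma SU2P g : SU2 g <-> exists a b,
  g = mx22 a b (- conjc b) (conjc a) /\ a * conjc a + b * conjc b = 1.
Proof.
split=> [[/unitarymxP gg g1]|[a [b [-> ab1]]]].
  have E : g ^t* = mx22 (g 1 1) (- g 0 1) (- g 1 0) (g 0 0).
    have gg' := mulmx1C gg.
    have := (adj_mx22 g); rewrite g1 => gadj.
    by rewrite -[LHS]mulmx1 -gadj mulmxA gg' mul1mx.
  have /(congr1 (fun M : 'M[R[i]]_2 => M 0 0)) := E.
  rewrite mx22E !mxE conjCE => E1.
  have /(congr1 (fun M : 'M[R[i]]_2 => M 0 1)) := E.
  rewrite mx22E !mxE conjCE => E2.
  exists (g 0 0), (g 0 1); split.
    rewrite {1}[g]mx22_eta -E1; congr mx22.
    by rewrite -[g 0 1]opprK -E2 rmorphN/= conjcK opprK.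
  rewrite -g1 det_mx22 -E1; congr (_ + _).
  by rewrite -[in conjc (g 0 1)](opprK (g 0 1)) -E2 rmorphN/= conjcK mulrN.
split.
  apply/unitarymxP; apply: mx22_ext; rewrite mul_mx22E !mxE /= !conjCE //;
    rewrite ?rmorphN/= ?conjcK//.
  - by rewrite mulrN addrC; ring.
  - ring.
  by rewrite mulrNN addrC -ab1; ring.
by rewrite det_mx22 !mx22E -ab1; ring.
Qed.

Lemma su2P X : su2 X <-> exists (x : R) b,
  X = mx22 (0 +i* x) b (- conjc b) (0 -i* x).
Proof.
split=> [[XX trX]|[x [b ->]]].
  have E i j : conjc (X j i) = - X i j.
    by have /(congr1 (fun M : 'M[R[i]]_2 => M i j)) := XX; rewrite !mxE conjCE.
  have E00 : X 0 0 = 0 +i* complex.Im (X 0 0).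
    have /(congr1 (@complex.Re R)) := E 0 0; rewrite cReJ cReN => E0.
    by apply: complex_eq => //=; lra.
  exists (complex.Im (X 0 0)), (X 0 1).
  rewrite {1}[X]mx22_eta; congr mx22 => //.
    by rewrite E opprK.
  have : X 1 1 = - X 0 0 by apply/eqP; rewrite -addr_eq0 addrC -mxtrace2 trX.
  by rewrite E00 => ->; apply: complex_eq => /=; rewrite ?oppr0.
split; last first.
  by rewrite mxtrace2 !mx22E; apply: complex_eq; rewrite cReImE /= ?addr0 ?subrr.
apply: mx22_ext; rewrite !mxE /= !conjCE ?rmorphN/= ?conjcK ?opprK//.
  by apply: complex_eq; rewrite ?cReImE /= ?oppr0.
by apply: complex_eq; rewrite ?cReImE /= ?oppr0 ?opprK.
Qed.

Lemma SU2_mul g h : SU2 g -> SU2 h -> SU2 (g *m h).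
Proof.
move=> [gu g1] [hu h1]; split; first exact: mul_unitarymx.
by rewrite det_mulmx g1 h1 mulr1.
Qed.

Lemma SU2_1 : SU2 (1%:M : 'M[R[i]]_2).
Proof.
by split; [apply/unitarymxP; rewrite trmx1 map_mx1 mul1mx|rewrite det1].
Qed.

Lemma SU2_adj g : SU2 g -> SU2 (g ^t* ) /\ (g *m g ^t* = 1%:M /\ g ^t* *m g = 1%:M).
Proof.
move=> /[dup] gSU [/unitarymxP gg g1]; have g'g := mulmx1C gg.
split=> //; have /SU2P[a [b [-> ab1]]] := gSU; apply/SU2P.
exists (conjc a), (- b); split.
  by apply: mx22_ext; rewrite !mxE /= ?conjCE// ?rmorphN/= ?conjcK ?opprK.
by rewrite rmorphN/= conjcK mulrNN -ab1; ring.
Qed.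

Lemma mnorm_SU2 g : SU2 g -> mnorm g <= 4.
Proof.
have E i j : SU2 g -> normc (g i j) <= 1.
  move=> /SU2P[a [b [-> ab1]]].
  have ab : (complex.Re a ^+ 2 + complex.Im a ^+ 2) + (complex.Re b ^+ 2 + complex.Im b ^+ 2) = 1.
    have /(congr1 (@complex.Re R)) := ab1; rewrite !cReImE /= => <-; ring.
  have sq (z : R[i]) : complex.Re z ^+ 2 + complex.Im z ^+ 2 <= 1 -> normc z <= 1.
    by case: z => x y /= xy; rewrite -(@sqrtr1 R) ler_wsqrtr.
  have [a1 b1] : normc a <= 1 /\ normc b <= 1.
    have := (sqr_ge0 (complex.Re a), sqr_ge0 (complex.Im a),
             sqr_ge0 (complex.Re b), sqr_ge0 (complex.Im b)).
    by move=> [[[? ?] ?] ?]; split; apply: sq; lra.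
  rewrite mxE; case: ifP => _; case: ifP => _ //.
    by rewrite normc_opp; case: (b) b1 => ? ? /=; rewrite sqrrN.
  by case: (a) a1 => ? ? /=; rewrite sqrrN.
move=> gSU; apply: (@le_trans _ _ (\sum_(i < 2) \sum_(j < 2) 1)).
  by apply: ler_sum => i _; apply: ler_sum => j _; exact: E.
by rewrite !sumr_const !card_ord -mulrnA.
Qed.

(** For X in su(2) this is the square root of the determinant; the eigenvalues of X are plus and
    minus i times it. *)
Definition su2_radius X : R := Num.sqrt (complex.Im (X 0 0) ^+ 2 + normc (X 0 1) ^+ 2).

(* As [X *m X = - r ^+ 2] for [r] the radius of [X], this is [exp (t X)]. When
   [r = 0], also [X = 0] and the junk value of [sin 0 / 0] does not matter. *)
Definition su2_exp X (t : R) : 'M[R[i]]_2 :=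
  (cos (su2_radius X * t))%:C *: 1%:M
  + (sin (su2_radius X * t) / su2_radius X)%:C *: X.

(** Cayley-Hamilton for a traceless matrix. *)
Lemma su2_radius_sq X : su2 X -> X *m X = (- su2_radius X ^+ 2)%:C *: 1%:M.
Proof.
move=> /su2P[x [b XE]]; rewrite /su2_radius sqr_sqrtr ?addr_ge0 ?sqr_ge0//.
rewrite XE !mx22E; case: b {XE} => b1 b2 /=.
rewrite sqr_sqrtr ?addr_ge0 ?sqr_ge0//.
by apply: mx22_ext; rewrite mul_mx22E !mx22E !mxE /=; apply: complex_eq;
   rewrite !cReImE /=; ring.
Qed.

Lemma su2_radius_eq0 X : su2 X -> su2_radius X = 0 -> X = 0.
Proof.
move=> /su2P[x [b ->]] /eqP; rewrite /su2_radius !mx22E sqrtr_eq0 /= => H.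
have x0 : x = 0 by have := sqr_ge0 (normc b); have := sqr_ge0 x; nra.
have b0 : b = 0.
  by apply: eq0_normc; have := sqr_ge0 (normc b); have := sqr_ge0 x; nra.
by rewrite x0 b0; apply: mx22_ext; rewrite !mxE /=; apply: complex_eq;
  rewrite /= ?oppr0.
Qed.

Lemma SU2_su2_exp X t : su2 X -> SU2 (su2_exp X t).
Proof.
move=> /[dup] Xsu /su2P[x [b XE]].
have rX := su2_radius_sq Xsu; rewrite /su2_exp; set r := su2_radius X in rX *.
(* This also holds for r = 0, where both sides vanish. *)
have sr : (sin (r * t) / r) ^+ 2 * r ^+ 2 = sin (r * t) ^+ 2.
  have [->|r0] := eqVneq r 0; first by rewrite mul0r sin0 mul0r expr0n/= mul0r.
  by field.
have cs := cos2Dsin2 (r * t).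
set c := cos _ in cs *; set s := sin _ / r in sr *.
have rr : r ^+ 2 = x ^+ 2 + normc b ^+ 2.
  by rewrite /r /su2_radius XE !mx22E sqr_sqrtr// addr_ge0 ?sqr_ge0.
apply/SU2P; exists (c +i* (s * x)), (s%:C * b); split.
  rewrite XE; case: (b) => b1 b2; apply: mx22_ext; rewrite !mxE /=;
    by apply: complex_eq; rewrite !cReImE /=; ring.
have {}rr : r ^+ 2 = x ^+ 2 + (complex.Re b ^+ 2 + complex.Im b ^+ 2).
  by rewrite rr; case: (b) => b1 b2 /=; rewrite sqr_sqrtr// addr_ge0 ?sqr_ge0.
have E : c ^+ 2 + s ^+ 2 * (x ^+ 2 + (complex.Re b ^+ 2 + complex.Im b ^+ 2)) = 1.
  by rewrite -rr sr.
by apply: complex_eq; rewrite !cReImE /= -?E; ring.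
Qed.

(** With X^2 = -r^2 these are the addition formulas of cosine and sine; for r = 0 the matrix X
    itself is 0. *)
Lemma su2_expD X s t : su2 X -> su2_exp X (s + t) = su2_exp X s *m su2_exp X t.
Proof.
move=> Xsu; have rX := su2_radius_sq Xsu; have r0 := su2_radius_eq0 Xsu.
rewrite /su2_exp; set r := su2_radius X in rX r0 *.
rewrite mulrDr cosD sinD.
rewrite mulmxDl !mulmxDr -!scalemxAl -!scalemxAr !mul1mx !mulmx1 rX.
have [r_0|rn0] := eqVneq r 0.
  rewrite (r0 r_0) !scaler0 ?addr0 r_0 !mul0r sin0 cos0 !mul0r ?subr0 !mulr1.
  by rewrite !scale1r add0r scale0r addr0.
rewrite !scalerA [_ *: X + _ *: 1%:M]addrC addrACA -!scalerDl; congr (_ *: _ + _ *: _);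
  by apply: complex_eq; rewrite !cReImE /=; field.
Qed.

Lemma su2_exp0 X : su2_exp X 0 = 1%:M.
Proof. by rewrite /su2_exp mulr0 cos0 sin0 mul0r scale1r scale0r addr0. Qed.

(** Write g as cos(th) plus a traceless part of radius sin(th), where th is the arc cosine of Re a;
    rescaling that part to radius th gives X. *)
Lemma su2_exp_surj g : SU2 g -> exists2 X, su2 X & g = su2_exp X 1.
Proof.
move=> /SU2P[a [b [-> ab1]]].
have E : complex.Re a ^+ 2 + (complex.Im a ^+ 2 + complex.Re b ^+ 2 + complex.Im b ^+ 2) = 1.
  have /(congr1 (@complex.Re R)) := ab1; rewrite !cReImE /= => <-; ring.
set y := complex.Im a ^+ 2 + _ + _ in E.
have y0 : 0 <= y by rewrite !addr_ge0 ?sqr_ge0.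
have a1 : -1 <= complex.Re a <= 1 by apply/andP; split; nra.
(* Here g is 1 or -1 and has no traceless part to rescale. For -1, an element of radius pi
   serves. *)
have [y_0|yn0] := eqVneq y 0.
  have sq0 : [/\ complex.Im a = 0, complex.Re b = 0 & complex.Im b = 0].
    have := (sqr_ge0 (complex.Im a), sqr_ge0 (complex.Re b), sqr_ge0 (complex.Im b)).
    by move: y_0; rewrite /y => ? [[? ?] ?]; split; nra.
  case: sq0 => a_0 b1 b2.
  have bE : b = 0 by apply: complex_eq.
  have [aE|aE] : complex.Re a = 1 \/ complex.Re a = - 1.
    have : (complex.Re a - 1) * (complex.Re a + 1) = 0 by nra.
    by move/eqP; rewrite mulf_eq0 => /orP[]/eqP ?; [left|right]; lra.
  - exists 0; first by apply/su2P; exists 0, 0; apply: mx22_ext; rewrite !mxE /=;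
      apply: complex_eq; rewrite /= ?oppr0.
    have -> : a = 1 by apply: complex_eq.
    have r0 : su2_radius 0 = 0 by rewrite /su2_radius !mxE normc0 /= expr0n addr0 sqrtr0.
    rewrite bE /su2_exp scaler0 addr0 r0 mul0r cos0 scale1r.
    by apply: mx22_ext; rewrite !mxE /= ?oppr0// rmorph1.
  - exists (mx22 (0 +i* pi) 0 (- conjc 0) (0 -i* pi)).
      by apply/su2P; exists pi, 0.
    have -> : a = -1 by apply: complex_eq => //=; rewrite oppr0.
    rewrite bE /su2_exp /su2_radius !mx22E normc0 expr0n/= addr0 sqrtr_sqr.
    rewrite ger0_norm ?pi_ge0// mulr1 cospi sinpi mul0r scale0r addr0.
    by apply: mx22_ext; rewrite !mxE /= ?oppr0 ?mulr0 ?mulr1//;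
       apply: complex_eq; rewrite ?cReImE /= ?oppr0.
have y_gt0 : 0 < y by rewrite lt_def yn0.
pose th := acos (complex.Re a); pose s := sin th.
have th0 : 0 <= th by exact: acos_ge0.
have s2 : s ^+ 2 = y.
  by have := cos2Dsin2 th; rewrite acosK ?in_itv//= -/s => ?; lra.
have s0 : 0 < s.
  rewrite lt_def; apply/andP; split; last by rewrite sin_ge0_pi// th0 acos_lepi.
  by apply: contra_neq yn0 => s_0; rewrite -s2 s_0 expr0n.
have thn0 : th != 0 by apply: contraTneq s0 => th_0; rewrite /s th_0 sin0 ltxx.
have th_gt0 : 0 < th by rewrite lt_def thn0.
(* The factor that brings the radius from s = sin(th) to th. *)
pose k := th / s.
exists (mx22 (0 +i* (k * complex.Im a)) (k%:C * b) (- conjc (k%:C * b))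
  (0 -i* (k * complex.Im a))).
  by apply/su2P; exists (k * complex.Im a), (k%:C * b).
have rE : su2_radius (mx22 (0 +i* (k * complex.Im a)) (k%:C * b) (- conjc (k%:C * b))
  (0 -i* (k * complex.Im a))) = th.
  rewrite /su2_radius !mx22E normcM normc_real [complex.Im _]/=.
  rewrite [(k * _) ^+ 2]exprMn [(`|k| * _) ^+ 2]exprMn.
  rewrite real_normK ?num_real// normc_sq -mulrDr addrA -/y.
  rewrite -s2 -exprMn sqrtr_sqr ger0_norm /k ?divfK ?gt_eqF//.
rewrite /su2_exp rE mulr1 acosK ?in_itv//= -/th -/s.
have kk : s / th * k = 1 by rewrite /k; field; rewrite thn0 gt_eqF.
have kE (z : R) : z = s / th * k * z by rewrite kk mul1r.
apply: mx22_ext; rewrite !mxE /= ?mulr0 ?mulr1 ?add0r; apply: complex_eq;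
  rewrite !cReImE /=; first [ring|by rewrite [LHS]kE; ring].
Qed.

Lemma mderiv_su2_exp X : su2 X -> mderiv (su2_exp X) 0 X.
Proof.
move=> Xsu; rewrite /su2_exp; have r0 := su2_radius_eq0 Xsu.
set r := su2_radius X in r0 *.
have A1 : is_derive (0 : R) 1 (fun u : R => r * u) r.
  have := @is_deriveZ R R R (@id R) r 0 1 1 (@is_derive_id _ _ _ _).
  by rewrite /GRing.scale/= mulr1.
have Dc := @is_derive1_comp _ cos (fun u : R => r * u) 0 _ _ (is_derive_cos _) A1.
have Ds := @is_derive1_comp _ sin (fun u : R => r * u) 0 _ _ (is_derive_sin _) A1.
have Ds' := @is_deriveZ R R R _ r^-1 0 1 _ Ds.
rewrite mulr0 sin0 oppr0 mul0r in Dc; rewrite mulr0 cos0 mul1r in Ds'.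
have Ms := mderiv_scale X Ds'; have Mc := mderiv_scale (1%:M : 'M[R[i]]_2) Dc.
have M := mderivD Mc Ms; apply: mderiv_eq.
  by apply: mderiv_ext M => u; congr (_ + _%:C *: _); rewrite mulrC.
have -> : r^-1 *: r = r^-1 * r by [].
rewrite scale0r add0r; have [r_0|rn0] := eqVneq r 0; first by rewrite (r0 r_0) scaler0.
by rewrite mulVf// scale1r.
Qed.

Lemma cvg_real_complex (u : R ^nat) (l : R) :
  (u @ \oo --> l) -> (fun n => (u n)%:C : R[i]) @ \oo --> l%:C.
Proof.
move=> /cvgrPdist_lt ul; apply/cvgrPdist_lt => e e0.
have eE : e = (complex.Re e)%:C.
  by rewrite RRe_real// ger0_real// ltW.
have e0' : 0 < complex.Re e by rewrite eE ltcR in e0.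
have := ul _ e0'; apply: filterS => n Hn.
by rewrite eE -rmorphB/= normc_def /= expr0n/= addr0 sqrtr_sqr ltcR.
Qed.

(** Even powers of X are scalar and odd powers are multiples of X, so the exponential series splits
    into a cosine series times 1 and a sine series times X / r. *)
Lemma expm_su2 X t : su2 X -> expm (t%:C *: X) = su2_exp X t.
Proof.
move=> Xsu; rewrite /expm /su2_exp.
have rX := su2_radius_sq Xsu; have r0 := su2_radius_eq0 Xsu.
set r := su2_radius X in rX r0 *.
have E2 k : X ^+ k.*2 = ((- r ^+ 2) ^+ k)%:C *: 1%:M.
  elim: k => [|k IH]; first by rewrite !expr0 scale1r.
  have -> : X ^+ k.+1.*2 = X *m X *m X ^+ k.*2.
    by rewrite doubleS !exprS -!mulmxE mulmxA.
  by rewrite rX IH -scalemxAl mul1mx scalerA -rmorphM -exprS.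
have E k : (k`!%:R)^-1 *: (t%:C *: X) ^+ k =
    (cos_coeff (r * t) k)%:C *: 1%:M + (sin_coeff (r * t) k / r)%:C *: X.
  rewrite exprZn scalerA /cos_coeff /sin_coeff /=.
  have -> : (k`!%:R)^-1 * t%:C ^+ k = (t ^+ k / k`!%:R)%:C.
    by rewrite mulrC rmorphM fmorphV !rmorphXn rmorph_nat.
  have [kE|kE] : k = k./2.*2 \/ k = k./2.*2.+1.
    by rewrite -{1 3}(odd_double_half k); case: (odd k); [right|left].
  - have -> : X ^+ k = ((- r ^+ 2) ^+ k./2)%:C *: 1%:M by rewrite -E2 -kE.
    rewrite scalerA -rmorphM.
    have -> : odd k = false by rewrite kE odd_double.
    rewrite /= !mul0r scale0r addr0 mul1r; congr (_%:C *: _).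
    have -> : (- r ^+ 2) ^+ k./2 = (-1) ^+ k./2 * r ^+ k.
      have -> : r ^+ k = (r ^+ 2) ^+ k./2 by rewrite -exprM mul2n -kE.
      by rewrite -exprMn mulN1r.
    rewrite exprMn -exprnP.
    by move: ((-1) ^+ k./2) (r ^+ k) (t ^+ k) (k`!%:R^-1 : R) => a b c d; ring.
  - have -> : X ^+ k = ((- r ^+ 2) ^+ k./2)%:C *: X.
      by rewrite {1}kE exprS -mulmxE E2 -scalemxAr mulmx1.
    rewrite scalerA -rmorphM.
    have -> : odd k by rewrite kE /= odd_double.
    rewrite /= !mul0r scale0r add0r mul1r.
    have [r_0|rn0] := eqVneq r 0; first by rewrite (r0 r_0) !scaler0.
    congr (_%:C *: _).
    have -> : (- r ^+ 2) ^+ k./2 = (-1) ^+ k./2 * r ^+ k / r.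
      have -> : r ^+ k = r * (r ^+ 2) ^+ k./2 by rewrite -exprM mul2n -exprS -kE.
      by rewrite mulrCA mulrAC mulfV// mul1r -exprMn mulN1r.
    have -> : k.-1./2 = k./2 by rewrite {1}kE /= doubleK.
    rewrite exprMn.
    by move: ((-1) ^+ k./2) (r ^+ k) (t ^+ k) (k`!%:R^-1 : R) => a b c d; field.
apply: (@cvg_lim _ (@norm_hausdorff _ _)).
have -> : series (fun k => (k`!%:R)^-1 *: (t%:C *: X) ^+ k) = (fun n =>
   (series (cos_coeff (r * t)) n)%:C *: (1%:M : 'M[R[i]]_2) +
   ((r^-1)%:C * (series (sin_coeff (r * t)) n)%:C) *: X).
  apply/funext => n; rewrite /series /= (eq_bigr _ (fun k _ => E k)) big_split /=.
  rewrite -!scaler_suml; congr (_ *: _ + _ *: _); first by rewrite rmorph_sum.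
  by rewrite rmorph_sum mulr_sumr; apply: eq_bigr => k _; rewrite -rmorphM mulrC.
rewrite [_ / r]mulrC rmorphM.
have Cc := cvg_real_complex (@is_cvg_series_cos_coeff R (r * t)).
have Cs := cvg_real_complex (@is_cvg_series_sin_coeff R (r * t)).
rewrite cos.unlock sin.unlock.
apply: cvgD; apply: cvgZr_tmp; first exact: Cc.
apply: cvgM; first exact: cvg_cst.
exact: Cs.
Qed.

End SU2.

(** * Differentiating continuous representations *)

Section Neighbourhoods.
Context {R : realType}.

(** This links the entrywise topology, in which representations are continuous, to the estimates in
    [mnorm]. *)
Lemma nbhs_mnormP m n (M : 'M[R[i]]_(m, n)) (B : set 'M[R[i]]_(m, n)) :
  nbhs M B <-> exists2 d : R, 0 < d & forall M', mnorm (M' - M) < d -> B M'.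
Proof.
split=> [/nbhs_ballP[e /= e0 eB]|[d d0 dB]].
  (* Balls over [R[i]] have radii in [R[i]]; a positive one is real. *)
  have eE : e = (complex.Re e)%:C by rewrite RRe_real// ger0_real// ltW.
  exists (complex.Re e); first by rewrite eE ltcR in e0.
  move=> M' MM'; apply: eB; split=> // i j.
  rewrite -ball_normE /ball_ /= eE normr_normc ltcR.
  apply: le_lt_trans MM'; rewrite mnormBC.
  by apply: le_trans (mnorm_entry _ i j); rewrite !mxE.
apply/nbhs_ballP; pose k : R := (m * n).+1%:R; have k0 : 0 < k by rewrite ltr0n.
exists (d / k)%:C; first by rewrite /= ltcR divr_gt0.
move=> M' [_ MM']; apply: dB.
apply: (@le_lt_trans _ _ (\sum_(i < m) \sum_(j < n) d / k)).
  apply: ler_sum => i _; apply: ler_sum => j _.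
  have := MM' i j; rewrite -ball_normE /ball_ /= normr_normc ltcR => /ltW.
  by apply: le_trans; rewrite -normc_opp !mxE opprB.
rewrite !sumr_const !card_ord -mulrnA mulnC -mulr_natr mulrAC ltr_pdivrMr//.
by rewrite ltr_pM2l// ltr_nat.
Qed.

(* A homomorphism that is within [1/2] of [1] on a ball maps the points whose
   first [K] powers lie in that ball to within [1/K] of [1]. *)
Lemma mnorm_powers_small N (Y : 'M[R[i]]_N) (K : nat) :
  (forall j, (j <= K.+1)%N -> mnorm (Y ^+ j - 1%:M) <= 2^-1) ->
  mnorm (Y - 1%:M) <= K.+1%:R^-1.
Proof.
move=> HY; have K0 : 0 < K.+1%:R :> R by rewrite ltr0n.
(* Comparing Y^(K+1) - 1 = (Y - 1) (1 + Y + ... + Y^K) with K+1 copies of Y - 1. For x the norm of Y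
   - 1, this yields (K+1) x <= 1/2 + x (K+1)/2, hence x <= 1/(K+1). *)
have E : K.+1%:R *: (Y - 1%:M) =
    (Y ^+ K.+1 - 1%:M) - (Y - 1%:M) *m \sum_(i < K.+1) (Y ^+ i - 1%:M).
  rewrite sumrB sumr_const card_ord mulmxBr.
  have /= -> := subrX1 Y K.+1.
  rewrite -mulmxE opprB addrCA subrr addr0.
  by rewrite -[1%:M *+ _](@scaler_nat R[i]) -scalemxAr mulmx1.
have : K.+1%:R * mnorm (Y - 1%:M) <= 2^-1 + mnorm (Y - 1%:M) * (K.+1%:R / 2).
  rewrite -[K.+1%:R in X in X <= _](gtr0_norm K0) -normc_real rmorph_nat -mnormZ E.
  apply: le_trans (mnormB _ _) _; apply: lerD; first exact: HY.
  apply: le_trans (mnormM _ _) _; apply: ler_wpM2l; first exact: mnorm_ge0.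
  apply: le_trans (mnorm_sum _) _.
  apply: (@le_trans _ _ (\sum_(i < K.+1) 2^-1)).
    by apply: ler_sum => i _; apply: HY; rewrite ltnW.
  by rewrite sumr_const card_ord -[X in X <= _]mulr_natl.
move=> H; rewrite -[leRHS]mul1r ler_pdivlMr//; nra.
Qed.

(** Each further factor g adds g^K (g - 1) to the difference, and g^K, being in SU(2), has norm at
    most 4. *)
Lemma mnorm_SU2_powers g K : SU2 (g : 'M[R[i]]_2) ->
  SU2 (g ^+ K) /\ mnorm (g ^+ K - 1%:M) <= K%:R * (4 * mnorm (g - 1%:M)).
Proof.
move=> gSU; elim: K => [|K [IH1 IH2]].
  by rewrite expr0 subrr mnorm0 mul0r; split=> //; exact: SU2_1.
rewrite exprSr -mulmxE; split; first exact: SU2_mul.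
have -> : g ^+ K *m g - 1%:M = g ^+ K *m (g - 1%:M) + (g ^+ K - 1%:M).
  by rewrite mulmxBr mulmx1 addrA subrK.
apply: le_trans (mnormD _ _) _; rewrite -natr1 mulrDl mul1r addrC.
apply: lerD => //; apply: le_trans (mnormM _ _) _.
by apply: ler_wpM2r; [exact: mnorm_ge0|exact: mnorm_SU2].
Qed.

Lemma mnorm_linear_bound m n p q (L : {linear 'M[R[i]]_(m, n) -> 'M[R[i]]_(p, q)}) :
  exists2 C : R, 0 < C & forall A, mnorm (L A) <= C * mnorm A.
Proof.
pose C := \sum_i \sum_j mnorm (L (delta_mx i j)).
have C0 : 0 <= C.
  by apply: sumr_ge0 => i _; apply: sumr_ge0 => j _; exact: mnorm_ge0.
exists (C + 1) => [|A]; first by rewrite ltr_wpDl.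
rewrite {1}(matrix_sum_delta A) linear_sum; apply: le_trans (mnorm_sum _) _.
apply: (@le_trans _ _ (C * mnorm A)); last first.
  by rewrite ler_wpM2r ?mnorm_ge0// lerDl.
rewrite /C mulr_suml; apply: ler_sum => i _; rewrite mulr_suml linear_sum.
apply: le_trans (mnorm_sum _) _; apply: ler_sum => j _.
by rewrite linearZ mnormZ mulrC ler_wpM2l ?mnorm_ge0// mnorm_entry.
Qed.

Lemma mderiv_linear m n p q (L : {linear 'M[R[i]]_(m, n) -> 'M[R[i]]_(p, q)}) F t D :
  mderiv F t D -> mderiv (fun u => L (F u)) t (L D).
Proof.
move=> /mderivP FD; apply/mderivP => e e0.
have [C C0 LC] := mnorm_linear_bound L.
apply: filterS (FD (e / C) (divr_gt0 e0 C0)) => h Fh.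
rewrite -linearZ -!linearB; apply: le_trans (LC _) _.
by rewrite -ler_pdivlMl// mulrA [_^-1 * _]mulrC.
Qed.

End Neighbourhoods.

Section RepresentationDerivative.
Context {R : realType} (psi : SU2_rep R).
Let N := \dim {:psi}.
Let b_basis := vbasisP {:psi}.

(* [end_mx] refers to row vectors, so [rep_mx] reverses products. *)
Definition rep_mx (g : 'M[R[i]]_2) : 'M[R[i]]_N := end_mx (rep_fun psi g).
Local Notation sigma := rep_mx.

Lemma rep_mx1 : sigma 1%:M = 1%:M.
Proof. by rewrite /rep_mx rep_one /end_mx passmx.mxof1// (basis_free b_basis). Qed.

Lemma rep_mxM g h : SU2 g -> SU2 h -> sigma (g *m h) = sigma h *m sigma g.
Proof.
move=> gS hS; rewrite /rep_mx rep_mul// /end_mx.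
by apply: passmx.mxof_comp; exact: vbasisP.
Qed.

Lemma rep_mx_continuous1 e : 0 < e -> exists2 d : R, 0 < d &
  forall g, SU2 g -> mnorm (g - 1%:M) < d -> mnorm (sigma g - 1%:M) <= e.
Proof.
move=> e0; have /subspace_continuousP := @rep_continuous R psi.
move=> /(_ 1%:M SU2_1) /(_ [set M | mnorm (M - 1%:M) <= e]).
have /[swap]/[apply] : nbhs (end_mx (rep_fun psi 1%:M)) [set M | mnorm (M - 1%:M) <= e].
  apply/nbhs_mnormP; exists e => // M'.
  by rewrite -/(sigma 1%:M) rep_mx1 => /ltW.
rewrite /nbhs/= /within => /nbhs_mnormP[d d0 Hd]; exists d => // g gS gd.
exact: Hd.
Qed.

Lemma rep_mxX g k : SU2 g -> sigma (g ^+ k) = sigma g ^+ k.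
Proof.
move=> gS; elim: k => [|k IH]; first by rewrite !expr0 rep_mx1.
rewrite exprSr -mulmxE rep_mxM ?IH//; first by rewrite mulmxE exprS.
by have [] := mnorm_SU2_powers k gS.
Qed.

(** A Lipschitz bound at 1, stated at the scales 1/(K+1). The threshold is a quarter of the radius
    of continuity because of the constant 4 in [mnorm_SU2_powers]. *)
Lemma rep_mx_lipschitz1 : exists2 d : R, 0 < d & forall K g, SU2 g ->
  mnorm (g - 1%:M) < d / K.+1%:R -> mnorm (sigma g - 1%:M) <= K.+1%:R^-1.
Proof.
have [|d d0 Hd] := @rep_mx_continuous1 2^-1; first by rewrite invr_gt0.
exists (d / 4) => [|K g gS gd]; first by rewrite divr_gt0.
apply: mnorm_powers_small => j jK; rewrite -rep_mxX//.
have [gjS gj] := mnorm_SU2_powers j gS; apply: Hd => //.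
apply: le_lt_trans gj _; rewrite mulrCA -ltr_pdivlMl//.
apply: le_lt_trans (_ : K.+1%:R * mnorm (g - 1%:M) < _).
  by rewrite ler_wpM2r ?mnorm_ge0// ler_nat.
by rewrite mulrC -ltr_pdivlMr ?ltr0n// [_^-1 * _]mulrC.
Qed.

(** By the Lipschitz bound, a curve that is 1 + o(t) in the group stays 1 + o(t) in the
    representation. *)
Lemma rep_mx_littleo (h : R -> 'M[R[i]]_2) : (forall t, SU2 (h t)) -> h 0 = 1%:M ->
  mderiv h 0 0 -> mderiv (fun t => sigma (h t)) 0 0.
Proof.
move=> hS h0 /mderivP hd; apply/mderivP => e e0.
have [d d0 Hd] := rep_mx_lipschitz1.
(* This range of t ensures 1 <= 1/(e|t|), which absorbs the rounding in [K2]. *)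
have small : \forall t \near (0 : R), e * `|t| <= 1.
  apply/nbhs_ballP; exists e^-1; first by rewrite /= invr_gt0.
  move=> t; rewrite /ball/= sub0r normrN => /ltW te.
  by rewrite mulrC -ler_pdivlMr// mul1r.
have e'0 : 0 < d * e / 4 by rewrite !(divr_gt0, mulr_gt0).
apply: filterS (filterI small (hd _ e'0)) => t [te].
rewrite addr0 scaler0 subr0 h0 rep_mx1 scaler0 subr0.
move=> ht; have [->|t0] := eqVneq t 0; first by rewrite h0 rep_mx1 subrr mnorm0 normr0 mulr0.
have et : 0 < e * `|t| by rewrite mulr_gt0// normr_gt0.
(* Then 1/(K+1) < e|t|, which is the desired bound, while K+1 <= 2/(e|t|) makes (K+1) times the norm
   of h(t) - 1 at most d/2 < d. *)
pose K := Num.trunc (e * `|t|)^-1.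
have K1 : (e * `|t|)^-1 < K.+1%:R by exact: truncnS_gt.
have K0 : 0 < K.+1%:R :> R by rewrite ltr0n.
have K2 : K.+1%:R <= 2 * (e * `|t|)^-1.
  have i0 : 0 <= (e * `|t|)^-1 by rewrite invr_ge0 ltW.
  have /andP[Kle _] := truncn_itv i0.
  rewrite -natr1 mulr2n mulrDl mul1r; apply: lerD => //.
  by rewrite -invr1 lef_pV2 ?posrE.
apply: (@le_trans _ _ K.+1%:R^-1); last first.
  by rewrite invf_ple ?posrE// ltW.
apply: Hd => //; apply: le_lt_trans ht _.
rewrite ltr_pdivlMr//; apply: le_lt_trans (ler_wpM2l _ K2) _.
  by rewrite mulr_ge0// ltW.
have tn0 : `|t| != 0 by rewrite normr_eq0.
have -> : d * e / 4 * `|t| * (2 * (e * `|t|)^-1) = d / 2.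
  by field; rewrite tn0 gt_eqF.
lra.
Qed.

Definition rep_curve (X : 'M[R[i]]_2) (t : R) := sigma (su2_exp X t).

Lemma one_param_rep X : su2 X -> one_param (rep_curve X).
Proof.
move=> Xsu.
have TD s t : rep_curve X (s + t) = rep_curve X s *m rep_curve X t.
  (* The swap of s and t compensates the reversal of products by [rep_mx]. *)
  by rewrite /rep_curve addrC su2_expD// rep_mxM//; exact: SU2_su2_exp.
split=> //; first by rewrite /rep_curve su2_exp0 rep_mx1.
apply: one_param_continuous => // e e0; have [d d0 Hd] := rep_mx_continuous1 e0.
have := mderiv_continuous (mderiv_su2_exp Xsu) (_ : 0 < d / 2).
move=> /(_ ltac:(by rewrite divr_gt0)); apply: filterS => h.
rewrite addr0 su2_exp0 => hd; apply: Hd; first exact: SU2_su2_exp.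
by apply: le_lt_trans hd _; lra.
Qed.

(** The curve exp(-tX) g(t) has zero velocity at 0, so [rep_mx_littleo] applies to it; the factor
    exp(tX) is then restored. *)
Lemma rep_mx_tangent (g : R -> 'M[R[i]]_2) X D : su2 X ->
  (forall t, SU2 (g t)) -> g 0 = 1%:M -> mderiv g 0 X ->
  mderiv (rep_curve X) 0 D -> mderiv (fun t => sigma (g t)) 0 D.
Proof.
move=> Xsu gS g0 gX XD.
pose h t := su2_exp X (- t) *m g t.
have hS t : SU2 (h t) by apply: SU2_mul => //; exact: SU2_su2_exp.
have h0 : h 0 = 1%:M by rewrite /h oppr0 su2_exp0 g0 mul1mx.
have hd : mderiv h 0 0.
  have EX : mderiv (su2_exp X) (- 0) X by rewrite oppr0; exact: mderiv_su2_exp.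
  apply: mderiv_eq (mderivM (mderiv_opp EX) gX) _.
  by rewrite g0 oppr0 su2_exp0 mulmx1 mul1mx addNr.
have := mderivM (rep_mx_littleo hS h0 hd) XD.
rewrite mul0mx add0r h0 rep_mx1 mul1mx; apply: mderiv_ext => u.
rewrite /rep_curve -rep_mxM//; last exact: SU2_su2_exp.
by rewrite /h mulmxA -su2_expD// subrr su2_exp0 mul1mx.
Qed.

End RepresentationDerivative.

(** * Coordinates on su(2) and its complexification *)

Section Su2Coordinates.
Context {R : realType}.
Implicit Types X Y : 'M[R[i]]_2.

Lemma su2_lin (a : R) X Y : su2 X -> su2 Y -> su2 (a%:C *: X + Y).
Proof.
move=> [X1 X2] [Y1 Y2]; split; last by rewrite mxtraceD mxtraceZ X2 Y2 mulr0 addr0.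
rewrite linearD/= linearZ/= map_mxD map_mxZ X1 Y1 /= conjCE conjc_real.
by rewrite scalerN opprD.
Qed.

Lemma su2_X1 : su2 (X1 R).
Proof.
apply/su2P; exists 0, (0 -i* 2^-1); apply: mx22_ext; rewrite !mxE /= half_complex;
  by apply: complex_eq; rewrite ?cReImE /=; ring.
Qed.

Lemma su2_X2 : su2 (X2 R).
Proof.
apply/su2P; exists 0, (- 2^-1)%:C; apply: mx22_ext; rewrite !mxE /= half_complex;
  by apply: complex_eq; rewrite ?cReImE /=; ring.
Qed.

Lemma su2_X3 : su2 (X3 R).
Proof.
apply/su2P; exists (- 2^-1), 0; apply: mx22_ext; rewrite !mxE /= half_complex;
  by apply: complex_eq; rewrite ?cReImE /=; ring.
Qed.

(** On traceless matrices, [su2_coord1], [su2_coord2] and [su2_coord3] are the coordinates in the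
    basis [X1], [X2], [X3]. *)
Definition su2_coord1 X : R[i] := 'i * (X 1 0 + X 0 1).
Definition su2_coord2 X : R[i] := X 1 0 - X 0 1.
Definition su2_coord3 X : R[i] := 'i * (X 0 0 - X 1 1).

(** The linear map with prescribed values at [X1], [X2], [X3]. It is defined on all matrices,
    killing the scalar ones, so that it can be a bundled linear map. *)
Definition su2_lift N (D1 D2 D3 : 'M[R[i]]_N) X : 'M[R[i]]_N :=
  su2_coord1 X *: D1 + su2_coord2 X *: D2 + su2_coord3 X *: D3.

Lemma su2_lift_is_linear N (D1 D2 D3 : 'M[R[i]]_N) : linear (su2_lift D1 D2 D3).
Proof.
move=> a X Y; rewrite /su2_lift.
have -> : su2_coord1 (a *: X + Y) = a * su2_coord1 X + su2_coord1 Y.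
  by rewrite /su2_coord1 !mxE; ring.
have -> : su2_coord2 (a *: X + Y) = a * su2_coord2 X + su2_coord2 Y.
  by rewrite /su2_coord2 !mxE; ring.
have -> : su2_coord3 (a *: X + Y) = a * su2_coord3 X + su2_coord3 Y.
  by rewrite /su2_coord3 !mxE; ring.
move: (su2_coord1 X) (su2_coord2 X) (su2_coord3 X) => x1 x2 x3.
move: (su2_coord1 Y) (su2_coord2 Y) (su2_coord3 Y) => y1 y2 y3.
rewrite !scalerDl !scalerDr !scalerA [RHS]addrACA; congr (_ + _).
by rewrite addrACA.
Qed.

HB.instance Definition _ N (D1 D2 D3 : 'M[R[i]]_N) :=
  GRing.isLinear.Build R[i] 'M[R[i]]_2 'M[R[i]]_N _ (su2_lift D1 D2 D3)
    (su2_lift_is_linear D1 D2 D3).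

Lemma su2_lift_id X : \tr X = 0 -> su2_lift (X1 R) (X2 R) (X3 R) X = X.
Proof.
rewrite mxtrace2 => trX; have X11 : X 1 1 = - X 0 0.
  by apply/eqP; rewrite -addr_eq0 addrC trX.
have E k l : su2_lift (X1 R) (X2 R) (X3 R) X k l = su2_coord1 X * X1 R k l +
    su2_coord2 X * X2 R k l + su2_coord3 X * X3 R k l.
  rewrite /su2_lift; move: (X1 R) (X2 R) (X3 R) => A B C.
  by rewrite !mxE.
(* The imaginary unit and 1/2 become variables known only through j^2 = -1 and q + q = 1, so that
   [ring] handles the entries. *)
pose j : R[i] := 'i.
have ii : j * j = -1 by apply: complex_eq; rewrite cReImE /=; ring.
have half2 : 2^-1 + 2^-1 = 1 :> R[i].
  by rewrite half_complex; apply: complex_eq; rewrite ?cReImE /=; field.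
have E1 : X1 R = 2^-1 *: mx22 0 (- j) (- j) 0 by [].
have E2 : X2 R = 2^-1 *: mx22 0 (- 1) 1 0 by [].
have E3 : X3 R = 2^-1 *: mx22 (- j) 0 0 j by [].
have C1 : su2_coord1 X = j * (X 1 0 + X 0 1) by [].
have C2 : su2_coord2 X = X 1 0 - X 0 1 by [].
have C3 : su2_coord3 X = j * (X 0 0 - X 1 1) by [].
rewrite E1 E2 E3 {}C1 {}C2 {}C3 X11 in E *; rewrite [RHS]mx22_eta X11.
move: (X 0 0) (X 0 1) (X 1 0) E => x y z; move: j ii (2^-1) half2 {E1 E2 E3} => j ii q half2 E.
apply: mx22_ext; rewrite E [X in _ + _ + _ * X]mxE [X in _ + _ * X + _]mxE.
all: rewrite [X in _ * X + _ + _]mxE !mx22E.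
- transitivity (- (j * j) * ((q + q) * x)); first by ring.
  by rewrite ii half2; ring.
- transitivity (- (j * j) * (q * (z + y)) - q * (z - y)); first by ring.
  rewrite ii; transitivity ((q + q) * y); first by ring.
  by rewrite half2 mul1r.
- transitivity (- (j * j) * (q * (z + y)) + q * (z - y)); first by ring.
  rewrite ii; transitivity ((q + q) * z); first by ring.
  by rewrite half2 mul1r.
transitivity ((j * j) * ((q + q) * x)); first by ring.
by rewrite ii half2; ring.
Qed.

(** On su(2) the coordinates are real, so real linearity of the derivative identifies it with a
    complex-linear [su2_lift]. *)
Lemma su2_coord_real X : su2 X ->
  [/\ su2_coord1 X = (complex.Re (su2_coord1 X))%:C,
      su2_coord2 X = (complex.Re (su2_coord2 X))%:C
    & su2_coord3 X = (complex.Re (su2_coord3 X))%:C].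
Proof.
move=> /su2P[x [b ->]]; rewrite /su2_coord1 /su2_coord2 /su2_coord3 !mx22E.
by split; apply: complex_eq; rewrite // !cReImE /=; ring.
Qed.

Lemma su2C_ind (P : 'M[R[i]]_2 -> Prop) :
  (forall a X Y, P X -> P Y -> P (a *: X + Y)) ->
  P (X1 R) -> P (X2 R) -> P (X3 R) -> forall X, X \in su2C R -> P X.
Proof.
move=> Plin P1 P2 P3 X; rewrite /su2C !span_cons span_nil addv0.
case/memv_addP => _ /vlineP[a ->] [_ /memv_addP[_ /vlineP[b ->] [w /vlineP[c ->] ->]] ->].
apply: (Plin) => //; apply: (Plin) => //.
(* The closure hypothesis does not supply [P 0], so the single multiple is written as a combination
   of two terms satisfying [P]. *)
have -> : c *: X3 R = (c - 1) *: X3 R + X3 R by rewrite scalerBl scale1r subrK.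
exact: Plin.
Qed.

End Su2Coordinates.

(** * The differential of a representation and its brackets *)

Section InducedRepresentation.
Context {R : realType} (psi : SU2_rep R).
Implicit Types X Y : 'M[R[i]]_2.

(** The product exp(atX) exp(tY) has tangent aX + Y at 0, so by [rep_mx_tangent] its image has the
    same derivative as that of exp(t(aX + Y)). *)
Lemma rep_curve_lin (a : R) X Y D E : su2 X -> su2 Y ->
  mderiv (rep_curve psi X) 0 D -> mderiv (rep_curve psi Y) 0 E ->
  mderiv (rep_curve psi (a%:C *: X + Y)) 0 (a%:C *: D + E).
Proof.
move=> Xsu Ysu XD YE; have XYsu := su2_lin a Xsu Ysu.
have [F XYF] := one_param_deriv0 (one_param_rep psi XYsu).
pose g t := su2_exp X (a * t + 0) *m su2_exp Y t.
have gS t : SU2 (g t) by apply: SU2_mul; exact: SU2_su2_exp.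
have g0 : g 0 = 1%:M by rewrite /g mulr0 addr0 !su2_exp0 mul1mx.
have gd : mderiv g 0 (a%:C *: X + Y).
  have EX : mderiv (su2_exp X) (a * 0 + 0) X.
    by rewrite mulr0 addr0; exact: mderiv_su2_exp.
  apply: mderiv_eq (mderivM (mderiv_affine EX) (mderiv_su2_exp Ysu)) _.
  by rewrite mulr0 addr0 !su2_exp0 mul1mx mulmx1.
have H1 := rep_mx_tangent XYsu gS g0 gd XYF.
have XD' : mderiv (rep_curve psi X) (a * 0 + 0) D by rewrite mulr0 addr0.
have := mderivM YE (mderiv_affine XD').
rewrite mulr0 addr0 /rep_curve !su2_exp0 rep_mx1 mul1mx mulmx1 addrC => H2.
rewrite (mderiv_unique (mderiv_ext _ H2) H1) => [|u]; first exact: XYF.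
by rewrite /g rep_mxM//; exact: SU2_su2_exp.
Qed.

(** The derivatives along [X1], [X2], [X3] determine a complex-linear map, and [rep_curve_lin] shows
    that it gives the derivative along every X in su(2). *)
Lemma rep_differential_exists : exists DD : {linear 'M[R[i]]_2 -> 'M[R[i]]_(\dim {:psi})},
  forall X, su2 X -> mderiv (rep_curve psi X) 0 (DD X).
Proof.
have [D1 H1] := one_param_deriv0 (one_param_rep psi su2_X1).
have [D2 H2] := one_param_deriv0 (one_param_rep psi su2_X2).
have [D3 H3] := one_param_deriv0 (one_param_rep psi su2_X3).
exists (su2_lift D1 D2 D3) => X Xsu; have [_ trX] := Xsu.
rewrite -{1}(su2_lift_id trX) /= /su2_lift; have [-> -> ->] := su2_coord_real Xsu.
rewrite -!addrA.
move: (complex.Re _) (complex.Re _) (complex.Re _) => x3 x2 x1.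
have N1 : (-1)%:C = -1 :> R[i] by apply: complex_eq; rewrite /= ?oppr0.
have su20 : su2 (0 : 'M[R[i]]_2).
  by have := su2_lin (-1) (@su2_X1 R) (@su2_X1 R); rewrite N1 scaleN1r addNr.
have H0 : mderiv (rep_curve psi 0) 0 0.
  have := rep_curve_lin (-1) (@su2_X1 R) (@su2_X1 R) H1 H1.
  by rewrite N1 !scaleN1r !addNr.
have scaleP (x : R) Z F : su2 Z -> mderiv (rep_curve psi Z) 0 F ->
    su2 (x%:C *: Z) /\ mderiv (rep_curve psi (x%:C *: Z)) 0 (x%:C *: F).
  move=> Zsu ZF; rewrite -[x%:C *: Z]addr0 -[x%:C *: F]addr0.
  by split; [exact: su2_lin|exact: rep_curve_lin].
have [S3' L3] := scaleP x3 _ _ (@su2_X3 R) H3.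
have L2 := rep_curve_lin x2 (@su2_X2 R) S3' H2 L3.
exact: (rep_curve_lin x1 (@su2_X1 R) (su2_lin x2 (@su2_X2 R) S3') H1 L2).
Qed.

Context (DD : {linear 'M[R[i]]_2 -> 'M[R[i]]_(\dim {:psi})}).
Context (HDD : forall X, su2 X -> mderiv (rep_curve psi X) 0 (DD X)).

Lemma su2_expN_adj X t : su2 X -> su2_exp X (- t) = su2_exp X t ^t*.
Proof.
move=> Xsu; have [_ [_ gg]] := SU2_adj (SU2_su2_exp t Xsu).
rewrite -[LHS]mul1mx -gg -mulmxA -su2_expD// subrr su2_exp0 mulmx1//.
Qed.

(** Differentiate, at s = 0, the image of the conjugate of exp(sY) by k = exp(tX). The conjugation
    appears inverted on the right because [rep_mx] reverses products. *)
Lemma rep_differential_Ad X Y t : su2 X -> su2 Y ->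
  DD (su2_exp X t *m Y *m su2_exp X (- t)) =
  rep_curve psi X (- t) *m DD Y *m rep_curve psi X t.
Proof.
move=> Xsu Ysu; pose k := su2_exp X t.
have kS : SU2 k by exact: SU2_su2_exp.
have kS' : SU2 (su2_exp X (- t)) by exact: SU2_su2_exp.
have k'k : su2_exp X (- t) *m k = 1%:M by rewrite -su2_expD// addNr su2_exp0.
have kk' : k *m su2_exp X (- t) = 1%:M by rewrite -su2_expD// subrr su2_exp0.
have Zsu : su2 (k *m Y *m su2_exp X (- t)).
  have [Y1 Y2] := Ysu; split; last by rewrite mxtrace_mulC mulmxA k'k mul1mx.
  rewrite su2_expN_adj// !trmx_mul !map_mxM/= Y1 -!map_trmx !trmxK -map_mx_comp.
  rewrite (map_mx_id (conjCK )) -/k.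
  by rewrite map_trmx mulNmx mulmxN mulmxA.
pose g s := k *m su2_exp Y s *m su2_exp X (- t).
have gS s : SU2 (g s) by apply: SU2_mul => //; apply: SU2_mul => //; exact: SU2_su2_exp.
have g0 : g 0 = 1%:M by rewrite /g su2_exp0 mulmx1 kk'.
have gd : mderiv g 0 (k *m Y *m su2_exp X (- t)).
  by apply: mderivMr; apply: mderivMl; exact: mderiv_su2_exp.
have H1 := rep_mx_tangent Zsu gS g0 gd (HDD Zsu).
have H2 := mderivMr (rep_curve psi X t) (mderivMl (rep_curve psi X (- t)) (HDD Ysu)).
apply: (mderiv_unique H1); apply: mderiv_ext H2 => u.
have uS : SU2 (su2_exp Y u) by exact: SU2_su2_exp.
by rewrite /g /rep_curve rep_mxM ?rep_mxM ?mulmxA//; exact: SU2_mul.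
Qed.

(** The derivative of [rep_differential_Ad] at t = 0; the reversal of products by [rep_mx] accounts
    for the order on the right. *)
Lemma rep_differential_bracket_su2 X Y : su2 X -> su2 Y ->
  DD (X *m Y - Y *m X) = DD Y *m DD X - DD X *m DD Y.
Proof.
move=> Xsu Ysu.
have EX' : mderiv (su2_exp X) (- 0) X by rewrite oppr0; exact: mderiv_su2_exp.
have TX' : mderiv (rep_curve psi X) (- 0) (DD X) by rewrite oppr0; exact: HDD.
have H1 : mderiv (fun t => DD (su2_exp X t *m Y *m su2_exp X (- t))) 0
    (DD (X *m Y - Y *m X)).
  apply: mderiv_linear.
  apply: mderiv_eq (mderivM (mderivMr Y (mderiv_su2_exp Xsu)) (mderiv_opp EX')) _.
  by rewrite oppr0 su2_exp0 mulmx1 mul1mx mulmxN.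
have H2 := mderivM (mderivMr (DD Y) (mderiv_opp TX')) (HDD Xsu).
rewrite /= oppr0 /rep_curve su2_exp0 rep_mx1 mulmx1 mul1mx in H2.
rewrite (mderiv_unique H1 (mderiv_ext _ H2)) => [|u].
  by rewrite mulNmx addrC.
by rewrite rep_differential_Ad.
Qed.

Lemma rep_differential_bracket X Y : X \in su2C R -> Y \in su2C R ->
  DD (X *m Y - Y *m X) = DD Y *m DD X - DD X *m DD Y.
Proof.
have step Z : (forall W, W = X1 R \/ W = X2 R \/ W = X3 R ->
     DD (W *m Z - Z *m W) = DD Z *m DD W - DD W *m DD Z) ->
   forall W, W \in su2C R -> DD (W *m Z - Z *m W) = DD Z *m DD W - DD W *m DD Z.
  move=> HZ; apply: su2C_ind; [|by apply: HZ; tauto..].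
  move=> a U V HU HV; rewrite !mulmxDl !mulmxDr -!scalemxAl -!scalemxAr.
  rewrite opprD addrACA -scalerBr linearP HU HV linearP.
  rewrite mulmxDl mulmxDr -scalemxAl -scalemxAr scalerBr opprD.
  by rewrite addrACA.
move=> XC YC; apply: (step) => // W HW.
have Wsu : su2 W by case: HW => [->|[->|->]]; [exact: su2_X1|exact: su2_X2|exact: su2_X3].
(* Antisymmetry exchanges the two arguments, so that the extension by linearity applies to the
   second one as well. *)
apply/eqP; rewrite -eqr_opp -linearN !opprB; apply/eqP.
apply: step => // Z HZ; apply: rep_differential_bracket_su2 => //.
by case: HZ => [->|[->|->]]; [exact: su2_X1|exact: su2_X2|exact: su2_X3].
Qed.

Definition rep_induced X : 'End(psi) :=
  passmx.hommx (vbasis {:psi}) (vbasis {:psi}) (DD X).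

Lemma end_mx_induced X : end_mx (rep_induced X) = DD X.
Proof. by rewrite /end_mx /rep_induced passmx.hommxK//; exact: vbasisP. Qed.

Lemma end_mx_inj (V : vectType R[i]) : injective (@end_mx R V).
Proof. by apply: can_inj (passmx.mxofK _ _); exact: vbasisP. Qed.

Lemma rep_induced_is_induced : is_induced_rep rep_induced.
Proof.
split=> [a X Y _ _|X Y XC YC|X Xsu].
- by rewrite /rep_induced linearP passmx.hommx_linear.
- apply: end_mx_inj; rewrite end_mx_induced rep_differential_bracket//.
  have subE (f g : 'End(psi)) : end_mx (f - g) = end_mx f - end_mx g.
    have := passmx.mxof_linear (vbasis {:psi}) (vbasis {:psi}) (-1) g f.
    by rewrite !scaleN1r /end_mx [f - g]addrC => ->; rewrite addrC.
  have compE (f g : 'End(psi)) : end_mx (f \o g)%VF = end_mx g *m end_mx f.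
    by apply: passmx.mxof_comp; exact: vbasisP.
  have E U V : DD V *m DD U = end_mx (rep_induced U \o rep_induced V)%VF.
    by rewrite compE -(end_mx_induced U) -(end_mx_induced V).
  by rewrite subE (E X Y) (E Y X).
rewrite /is_differential_at end_mx_induced => B /nbhs_mnormP[d d0 dB].
have /mderivP/(_ (d / 2)) := HDD Xsu; rewrite divr_gt0// => /(_ isT) H.
rewrite /nbhs/= /dnbhs /within; apply: filterS H => t /= Ht t0; apply: dB.
rewrite expm_su2// -/(rep_mx psi _) -/(rep_mx psi _) -/(rep_curve psi _ _).
have -> : (t^-1)%:C *: (rep_curve psi X t - rep_mx psi 1%:M) - DD X =
   (t^-1)%:C *: (rep_curve psi X (t + 0) - rep_curve psi X 0 - t%:C *: DD X).
  rewrite addr0 [rep_curve psi X 0]/rep_curve su2_exp0 [RHS]scalerBr scalerA.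
  by rewrite -rmorphM mulVf// scale1r.
rewrite mnormZ normc_real normfV ltr_pdivrMl ?normr_gt0//.
apply: le_lt_trans Ht _; rewrite mulrC ltr_pM2l ?normr_gt0//; lra.
Qed.

End InducedRepresentation.

(** * Representations of sl(2) *)

Section Sl2.
Context {K : numClosedFieldType} {V : vectType K}.

(** The values [lam j] are distinct roots of the characteristic polynomial, whose degree is the
    dimension. *)
Lemma eigenvectors_le_dim (f : 'End(V)) (lam : nat -> K) (v : nat -> V) m :
  {in gtn m &, injective lam} ->
  (forall j, (j < m)%N -> v j != 0 /\ f (v j) = lam j *: v j) ->
  (m <= \dim {:V})%N.
Proof.
move=> lam_inj fv; pose e := vbasis {:V}; have eB : basis_of {:V} e := vbasisP _.
pose g := mxof e e f.
have cp0 : char_poly g != 0 by rewrite -size_poly_eq0 size_char_poly.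
have := @max_poly_roots _ (char_poly g) [seq lam j | j <- iota 0 m] cp0.
rewrite size_char_poly ltnS size_map size_iota; apply.
  apply/allP => x /mapP[j]; rewrite mem_iota add0n => /andP[_ jm] ->.
  have [v0 fvj] := fv j jm.
  rewrite -eigenvalue_root_char; apply/eigenvalueP; exists (rVof e (v j)).
    by rewrite -rVof_app// fvj linearZ.
  by rewrite rVof_eq0.
rewrite map_inj_in_uniq ?iota_uniq// => i j; rewrite !mem_iota add0n /=.
exact: lam_inj.
Qed.

Lemma eigenvector_exists (f : 'End(V)) : (0 < \dim {:V})%N ->
  exists (a : K) (v : V), v != 0 /\ f v = a *: v.
Proof.
move=> dV; pose e := vbasis {:V}; have eB : basis_of {:V} e := vbasisP _.
have [a /eigenvalueP[u fu u0]] := eigenvalue_closed (mxof e e f) dV.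
exists a, (vecof e u); split; first by rewrite vecof_eq0.
by rewrite (hom_vecof e eB) fu linearZ.
Qed.

Context (H E F : 'End(V)).
Context (HE : forall v, H (E v) = E (H v) + E v).
Context (HF : forall v, H (F v) = F (H v) - F v).
Context (EF : forall v, E (F v) = F (E v) + 2 *: H v).

Lemma natr_shift_inj (a : K) m : {in gtn m &, injective (fun j : nat => a + j%:R)}.
Proof. by move=> i j _ _ /addrI/eqP; rewrite eqr_nat => /eqP. Qed.

Lemma highest_weight_vector : (0 < \dim {:V})%N ->
  exists (a : K) (v : V), [/\ v != 0, H v = a *: v & E v = 0].
Proof.
move=> dV; have [a [v [v0 Hv]]] := eigenvector_exists H dV.
pose u k := iter k E v.
have Hu k : H (u k) = (a + k%:R) *: u k.
  elim: k => [|k IH]; first by rewrite addr0.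
  by rewrite /u iterS HE -/(u k) IH linearZ -natr1 addrA scalerDl scale1r.
have [k uk] : exists k, u k.+1 == 0.
  apply: contrapT => nz; have uN0 k : u k != 0.
    by case: k => [//|k]; apply/negP => uk; apply: nz; exists k.
  have := @eigenvectors_le_dim H (fun j => a + j%:R) u (\dim {:V}).+1
    (natr_shift_inj (m := _)) (fun j _ => conj (uN0 j) (Hu j)).
  by rewrite ltnn.
have ex : exists k, u k.+1 == 0 by exists k.
exists (a + (ex_minn ex)%:R), (u (ex_minn ex)); split=> //.
  case: ex_minnP => -[//|m] _ /(_ m) /implyP; rewrite ltnn implybF //.
by case: ex_minnP => m /eqP.
Qed.

(** Moving E past the successive factors F contributes 2 (a - i) for i = 0, ..., j, with sum (j + 1)
    (2 a - j). *)
Lemma sl2_string (a : K) (v : V) j : H v = a *: v -> E v = 0 ->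
  H (iter j F v) = (a - j%:R) *: iter j F v /\
  E (iter j.+1 F v) = (j.+1%:R * (2 * a - j%:R)) *: iter j F v.
Proof.
move=> Hv Ev.
have Hj k : H (iter k F v) = (a - k%:R) *: iter k F v.
  elim: k => [|k IH]; first by rewrite subr0.
  rewrite iterS HF IH linearZ -natr1 opprD addrA [RHS]scalerBl scale1r//.
split=> //; elim: j => [|j IH]; rewrite iterS EF.
  by rewrite Ev linear0 add0r Hv scalerA subr0 mul1r.
rewrite IH linearZ Hj scalerA -scalerDl; congr (_ *: _).
by rewrite -!natr1; ring.
Qed.

Context (irr : forall U : {vspace V}, U <> 0%VS ->
  (H @: U <= U)%VS -> (E @: U <= U)%VS -> (F @: U <= U)%VS -> U = {:V}%VS).

(** Let m + 1 be the first power of F that kills v. The vectors up to F^m v span a stable subspace,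
    hence everything, and have distinct weights, so m = n. *)
Lemma sl2_irreducible_string n : \dim {:V} = n.+1 -> exists v : V,
  [/\ forall j, (j <= n)%N -> iter j F v != 0, iter n.+1 F v = 0,
      H v = (n%:R / 2) *: v, E v = 0 &
      ({:V} <= <<[seq iter j F v | j <- iota 0 n.+1]>>)%VS].
Proof.
move=> dV; have dV0 : (0 < \dim {:V})%N by rewrite dV.
have [a [v [v0 Hv Ev]]] := highest_weight_vector dV0.
have S j := sl2_string j Hv Ev.
have le_nz m : (forall j, (j < m)%N -> iter j F v != 0) -> (m <= n.+1)%N.
  move=> nz; rewrite -dV.
  apply: (@eigenvectors_le_dim H (fun j => a - j%:R) (fun j => iter j F v)).
    by move=> i j _ _ /addrI/oppr_inj/eqP; rewrite eqr_nat => /eqP.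
  by move=> j jm; split; [exact: nz|have [] := S j].
have ex : exists k, iter k F v == 0.
  apply: contrapT => nz; have := le_nz n.+2; rewrite ltnn => /(_ _)/negP; apply => //.
  by move=> j _; apply/negP => Fj; apply: nz; exists j.
have [k k0 kmin] := ex_minnP ex.
case: k k0 kmin => [|m /eqP m0 mmin]; first by rewrite /= (negPf v0).
have nz j : (j <= m)%N -> iter j F v != 0.
  by move=> jm; apply/negP => /mmin; rewrite ltnNge jm.
have mn : (m <= n)%N by rewrite -ltnS; apply: le_nz => j; rewrite ltnS; exact: nz.
(* Applying E to F^(m+1) v = 0 gives (m + 1) (2 a - m) F^m v = 0. *)
have aE : a = m%:R / 2.
  have [_] := S m; rewrite m0 linear0 => /esym/eqP.
  rewrite scaler_eq0 (negPf (nz _ (leqnn m))) orbF mulf_eq0 pnatr_eq0 /= subr_eq0.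
  by move=> /eqP <-; rewrite mulrC mulKf// pnatr_eq0.
set X := [seq iter j F v | j <- iota 0 m.+1].
have XP j : (j <= m)%N -> iter j F v \in <<X>>%VS.
  by move=> jm; apply: memv_span; apply/mapP; exists j; rewrite ?mem_iota.
have stable (f : 'End(V)) : (forall j, (j <= m)%N -> f (iter j F v) \in <<X>>%VS) ->
    (f @: <<X>> <= <<X>>)%VS.
  move=> fX; rewrite limg_span; apply/span_subvP => x /mapP[y /mapP[j]].
  by rewrite mem_iota add0n /= => jm -> ->; exact: fX.
have Xfull : <<X>>%VS = {:V}%VS.
  apply: irr.
  - move=> X0; have := XP 0%N (leq0n _); rewrite X0 memv0 /= => /eqP vz.
    by rewrite vz eqxx in v0.
  - by apply: stable => j jm; have [-> _] := S j; rewrite memvZ// XP.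
  - apply: stable => -[_|j jm]; first by rewrite /= Ev mem0v.
    by have [_ ->] := S j; rewrite memvZ// XP// ltnW.
  apply: stable => j jm; rewrite -iterS.
  have [->|/negP jm'] := eqVneq j m; first by rewrite m0 mem0v.
  by apply: XP; rewrite ltn_neqAle jm andbT; apply/negP.
have nm : m = n.
  apply/eqP; rewrite eqn_leq mn -ltnS -dV -Xfull.
  by apply: leq_trans (dim_span _) _; rewrite size_map size_iota.
by exists v; rewrite -nm; split=> //; [rewrite Hv aE|rewrite -/X Xfull].
Qed.

End Sl2.

(** * Rescaling a weight string to the spin matrices *)

Section SpinBasis.
Context {R : realType}.

(** At the weight m = s - 1 - i, the radicand of [spin_b] is the coefficient (i + 1) (2 s - i) of
    [sl2_string] for highest weight s. *)
Lemma spin_b_sq (s : R) n i : 2 * s = n%:R -> (i < n)%N ->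
  0 < spin_b s (s - 1 - i%:R) /\
  spin_b s (s - 1 - i%:R) ^+ 2 = i.+1%:R * (2 * s - i%:R).
Proof.
move=> sn lt_in.
have E : s * (s + 1) - (s - 1 - i%:R) * (s - 1 - i%:R + 1) = i.+1%:R * (2 * s - i%:R).
  by rewrite -natr1; ring.
have pos : 0 < i.+1%:R * (2 * s - i%:R) by rewrite mulr_gt0// subr_gt0 sn ltr_nat.
by rewrite /spin_b E; split; [rewrite sqrtr_gt0|rewrite sqr_sqrtr// ltW].
Qed.

Lemma sl2_spin_basis (V : vectType R[i]) (H E F : 'End(V)) (s : R) n :
  2 * s = n%:R -> \dim {:V} = n.+1 ->
  (forall v, H (E v) = E (H v) + E v) -> (forall v, H (F v) = F (H v) - F v) ->
  (forall v, E (F v) = F (E v) + 2 *: H v) ->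
  (forall U : {vspace V}, U <> 0%VS ->
    (H @: U <= U)%VS -> (E @: U <= U)%VS -> (F @: U <= U)%VS -> U = {:V}%VS) ->
  exists e : n.+1.-tuple V, [/\ basis_of {:V} e, has_matrix e H (spin_S3 s n.+1),
    has_matrix e E (spin_Splus s n.+1) & has_matrix e F (spin_Sminus s n.+1)].
Proof.
move=> sn dV HE HF EF irr.
have [v [vnz vn Hv Ev Vspan]] := sl2_irreducible_string HE HF EF irr dV.
have S j := sl2_string HF EF j Hv Ev.
have aE : n%:R / 2 = s%:C :> R[i].
  have -> : n%:R = (2 * s)%:C :> R[i] by rewrite sn rmorph_nat.
  by rewrite rmorphM rmorph_nat mulrC mulKf// pnatr_eq0.
pose b j : R[i] := (spin_b s (s - 1 - j%:R))%:C.
have b0 j : (j < n)%N -> b j != 0.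
  by move=> jn; have [bp _] := spin_b_sq sn jn; rewrite eq_complex /= gt_eqF.
have bb j : (j < n)%N -> b j * b j = j.+1%:R * (2 * s%:C - j%:R).
  move=> jn; have [_ b2] := spin_b_sq sn jn.
  by rewrite -rmorphM -expr2 b2 rmorphM rmorphB rmorphM !rmorph_nat.
(* Dividing F^j v by b_0 ... b_(j-1) makes F w_j = b_j w_(j+1). Since E F^(j+1) v = b_j^2 F^j v, it
   also makes E w_(j+1) = b_j w_j. *)
pose a j : R[i] := \prod_(k < j) (b k)^-1.
have aS j : a j.+1 = a j / b j by rewrite /a big_ord_recr.
have a0 j : (j <= n)%N -> a j != 0.
  elim: j => [|j IH] jn; first by rewrite /a big_ord0 oner_eq0.
  by rewrite aS mulf_neq0 ?IH ?invr_eq0 ?b0// ltnW.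
pose w j := a j *: iter j F v.
have Hw j : H (w j) = (s - j%:R)%:C *: w j.
  by rewrite /w linearZ /= (S j).1 aE rmorphB rmorph_nat !scalerA mulrC.
have Fw j : (j < n)%N -> F (w j) = b j *: w j.+1.
  move=> jn; rewrite /w linearZ /= -iterS scalerA aS mulrC divfK ?b0//.
have Fwn : F (w n) = 0 by rewrite /w linearZ /= -iterS vn scaler0.
have Ew0 : E (w 0%N) = 0 by rewrite /w linearZ /= Ev scaler0.
have Ew j : (j < n)%N -> E (w j.+1) = b j *: w j.
  move=> jn; have /= [_ ES] := S j; rewrite /w linearZ /= ES aE -bb// !scalerA aS; congr (_ *: _).
  by rewrite mulrA divfK ?b0// mulrC.
exists [tuple w i | i < n.+1]; split.
- rewrite basisEdim size_tuple dV leqnn andbT; apply: subv_trans Vspan _.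
  apply/span_subvP => x /mapP[j]; rewrite mem_iota add0n /= => jn ->.
  have -> : iter j F v = (a j)^-1 *: w j.
    by rewrite /w scalerA mulVf ?scale1r// a0.
  apply: memvZ; apply: memv_span; apply/mapP; exists (Ordinal jn) => //.
  by rewrite mem_enum.
- move=> j; rewrite tnth_mktuple Hw (bigD1 j)//= big1 ?addr0.
    by rewrite mxE eqxx tnth_mktuple.
  by move=> i /negPf ij; rewrite mxE ij scale0r.
- move=> j; rewrite tnth_mktuple; case: j => -[|j] lt_j /=.
    rewrite Ew0 big1// => i _; rewrite mxE /= scale0r//.
  have lt_j' : (j < n.+1)%N by exact: ltnW.
  rewrite Ew// (bigD1 (Ordinal lt_j'))//= big1 ?addr0.
    by rewrite mxE /= eqxx tnth_mktuple.
  move=> i /negPf ij; rewrite mxE /= eqSS; case: eqP => [ji|_]; last by rewrite scale0r.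
  by move: ij; rewrite -val_eqE /= ji eqxx.
move=> j; rewrite tnth_mktuple; have [jn|jn] := ltnP j n.
  have lt_j' : (j.+1 < n.+1)%N by [].
  rewrite Fw// (bigD1 (Ordinal lt_j'))//= big1 ?addr0.
    by rewrite mxE /= eqxx tnth_mktuple.
  move=> i /negPf ij; rewrite mxE /=; case: eqP => [ji|_]; last by rewrite scale0r.
  by move: ij; rewrite -val_eqE /= ji eqxx.
(* The last column is zero: F kills the lowest weight vector. *)
have -> : j = n :> nat by apply/eqP; rewrite eqn_leq jn -ltnS ltn_ord.
rewrite Fwn big1// => i _; rewrite mxE; case: eqP => [ij|_]; last by rewrite scale0r.
by have := ltn_ord i; rewrite ij ltnS ltnNge jn.
Qed.

End SpinBasis.

(** * Matrices and commutators of the spin operators *)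

Section SpinOperators.
Context {R : realType}.

Lemma S3_mx22 : S3 R = mx22 (2^-1)%:C 0 0 (- 2^-1)%:C.
Proof.
rewrite /S3 /X3 half_complex; apply: mx22_ext; rewrite !mxE /=;
  by apply: complex_eq; rewrite !cReImE /=; ring.
Qed.

Lemma S1_mx22 : S1 R = mx22 0 (2^-1)%:C (2^-1)%:C 0.
Proof.
rewrite /S1 /X1 half_complex; apply: mx22_ext; rewrite !mxE /=;
  by apply: complex_eq; rewrite !cReImE /=; ring.
Qed.

Lemma S2_mx22 : S2 R = mx22 0 (0 -i* 2^-1) (0 +i* 2^-1) 0.
Proof.
rewrite /S2 /X2 half_complex; apply: mx22_ext; rewrite !mxE /=;
  by apply: complex_eq; rewrite !cReImE /=; ring.
Qed.

Lemma Splus_mx22 : Splus R = mx22 0 1 0 0.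
Proof.
rewrite /Splus S1_mx22 S2_mx22; apply: mx22_ext; rewrite !mxE /=;
  by apply: complex_eq; rewrite !cReImE /=; field.
Qed.

Lemma Sminus_mx22 : Sminus R = mx22 0 0 1 0.
Proof.
rewrite /Sminus S1_mx22 S2_mx22; apply: mx22_ext; rewrite !mxE /=;
  by apply: complex_eq; rewrite !cReImE /=; field.
Qed.

Lemma X1_ladder : X1 R = (- 'i / 2) *: (Splus R + Sminus R).
Proof.
rewrite Splus_mx22 Sminus_mx22 /X1 half_complex; apply: mx22_ext; rewrite !mxE /=;
  by apply: complex_eq; rewrite !cReImE /=; field.
Qed.

Lemma X2_ladder : X2 R = (- 1 / 2) *: (Splus R - Sminus R).
Proof.
rewrite Splus_mx22 Sminus_mx22 /X2 half_complex; apply: mx22_ext; rewrite !mxE /=;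
  by apply: complex_eq; rewrite !cReImE /=; field.
Qed.

Lemma X3_S3 : X3 R = (- 'i) *: S3 R.
Proof.
rewrite S3_mx22 /X3 half_complex; apply: mx22_ext; rewrite !mxE /=;
  by apply: complex_eq; rewrite !cReImE /=; field.
Qed.

Lemma traceless_su2C (X : 'M[R[i]]_2) : \tr X = 0 -> X \in su2C R.
Proof.
move=> trX; rewrite -(su2_lift_id trX) /su2_lift /su2C !span_cons span_nil addv0.
rewrite -addrA; apply: memv_add; first by rewrite memvZ// memv_line.
by apply: memv_add; rewrite memvZ// memv_line.
Qed.

Lemma S3_su2C : S3 R \in su2C R.
Proof.
apply: traceless_su2C; rewrite mxtrace2 S3_mx22 !mx22E.
by rewrite -rmorphD subrr.
Qed.

Lemma Splus_su2C : Splus R \in su2C R.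
Proof. by apply: traceless_su2C; rewrite mxtrace2 Splus_mx22 !mx22E addr0. Qed.

Lemma Sminus_su2C : Sminus R \in su2C R.
Proof. by apply: traceless_su2C; rewrite mxtrace2 Sminus_mx22 !mx22E addr0. Qed.

Lemma comm_S3_Splus : S3 R *m Splus R - Splus R *m S3 R = Splus R.
Proof.
rewrite S3_mx22 Splus_mx22 !mul_mx22; apply: mx22_ext; rewrite !mxE /=;
  by apply: complex_eq; rewrite !cReImE /=; field.
Qed.

Lemma comm_S3_Sminus : S3 R *m Sminus R - Sminus R *m S3 R = - Sminus R.
Proof.
rewrite S3_mx22 Sminus_mx22 !mul_mx22; apply: mx22_ext; rewrite !mxE /=;
  by apply: complex_eq; rewrite !cReImE /=; field.
Qed.

Lemma comm_Splus_Sminus : Splus R *m Sminus R - Sminus R *m Splus R = 2 *: S3 R.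
Proof.
rewrite S3_mx22 Splus_mx22 Sminus_mx22 !mul_mx22; apply: mx22_ext; rewrite !mxE /=;
  by apply: complex_eq; rewrite !cReImE /=; field.
Qed.

End SpinOperators.

(** Insert p + q = 1 between T and A; the term through p vanishes. For T a one-parameter group with
    generator A, this gives p T q a linear differential equation of its own. *)
Lemma mulmx_projections (K : pzRingType) N (p q T A : 'M[K]_N) :
  p + q = 1%:M -> p *m A *m q = 0 ->
  p *m (T *m A) *m q = p *m T *m q *m (A *m q).
Proof.
move=> pq1 pAq; rewrite -[T in LHS]mulmx1 -pq1 mulmxDr mulmxDl mulmxDr mulmxDl.
rewrite -[X in X + _ = _](_ : p *m (T *m (p *m A *m q)) = _); last by rewrite !mulmxA.
by rewrite pAq !mulmx0 add0r !mulmxA.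
Qed.

(** * From the Lie algebra to the group *)

Section Irreducible.
Context {R : realType} (psi : SU2_rep R).
Context (DD : {linear 'M[R[i]]_2 -> 'M[R[i]]_(\dim {:psi})}).
Context (HDD : forall X, su2 X -> mderiv (rep_curve psi X) 0 (DD X)).
Context (Phi : 'M[R[i]]_2 -> 'End(psi)).
Context (PhiE : Phi = rep_induced DD).

Lemma rep_inducedZ a X : Phi (a *: X) = a *: Phi X.
Proof. by rewrite PhiE /rep_induced linearZ linearZ. Qed.

Lemma rep_inducedD X Y : Phi (X + Y) = Phi X + Phi Y.
Proof. by rewrite PhiE /rep_induced linearD linearD. Qed.

Lemma rep_inducedN X : Phi (- X) = - Phi X.
Proof. by rewrite PhiE /rep_induced linearN linearN. Qed.

Lemma rep_induced_stable_su2 (U : {vspace psi}) :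
  (Phi (S3 R) @: U <= U)%VS -> (Phi (Splus R) @: U <= U)%VS ->
  (Phi (Sminus R) @: U <= U)%VS ->
  forall X, su2 X -> (Phi X @: U <= U)%VS.
Proof.
have lP (f : 'End(psi)) : (f @: U <= U)%VS <-> forall u, u \in U -> f u \in U.
  split=> [fU u uU|fU]; first by apply: (subvP fU); exact: memv_img.
  by apply/subvP => _ /memv_imgP[u uU ->]; exact: fU.
move=> /lP U3 /lP Up /lP Um X [_ trX]; apply/lP => u uU.
have UZ (a : R[i]) (Z : 'M[R[i]]_2) : (Phi Z u \in U) -> Phi (a *: Z) u \in U.
  by move=> ZU; rewrite rep_inducedZ scale_lfunE memvZ.
have UD (Z W : 'M[R[i]]_2) : (Phi Z u \in U) -> (Phi W u \in U) -> Phi (Z + W) u \in U.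
  by move=> ZU WU; rewrite rep_inducedD add_lfunE memvD.
have X1U : Phi (X1 R) u \in U.
  by rewrite X1_ladder; apply: (UZ); apply: (UD); [exact: Up|exact: Um].
have X2U : Phi (X2 R) u \in U.
  rewrite X2_ladder; apply: (UZ); apply: (UD); first exact: Up.
  by rewrite rep_inducedN opp_lfunE memvN; exact: Um.
have X3U : Phi (X3 R) u \in U by rewrite X3_S3; apply: (UZ); exact: U3.
rewrite -(su2_lift_id trX) /su2_lift.
exact: UD _ _ (UD _ _ (UZ _ _ X1U) (UZ _ _ X2U)) (UZ _ _ X3U).
Qed.

(** With p the matrix of the projection onto U and q = 1 - p, stability of U under f reads p f q =
    0. The curve p T(t) q starts at 0 and solves a linear equation, so it vanishes; every group
    element is reached at t = 1. *)
Lemma induced_stable_rep_stable (U : {vspace psi}) :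
  (forall X, su2 X -> (Phi X @: U <= U)%VS) ->
  forall g, SU2 g -> (rep_fun psi g @: U <= U)%VS.
Proof.
move=> HU g /su2_exp_surj[X Xsu ->].
pose b := vbasis {:psi}; have bB : basis_of {:psi} b := vbasisP _.
pose p := mxof b b (projv U); pose q := 1%:M - p.
have compE (f h : 'End(psi)) : mxof b b (f \o h)%VF = mxof b b h *m mxof b b f.
  exact: mxof_comp.
have pp : p *m p = p.
  rewrite -compE; congr (mxof b b _); apply/lfunP => u.
  by rewrite comp_lfunE projv_id// memv_proj.
have pq : p *m q = 0 by rewrite mulmxBr mulmx1 pp subrr.
have qq : q *m q = q by rewrite mulmxBl mul1mx pq subr0.
have stableE (f : 'End(psi)) : (f @: U <= U)%VS <-> p *m mxof b b f *m q = 0.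
  have -> : p *m mxof b b f *m q = mxof b b ((f \o projv U)%VF - (projv U \o (f \o projv U))%VF).
    by rewrite [RHS]linearB /= !compE mulmxBr mulmx1.
  split=> [fU|/eqP]; last first.
    rewrite mxof_eq0// subr_eq0 => /eqP E; apply/subvP => _ /memv_imgP[u uU ->].
    have := congr1 (fun h : 'End(psi) => h u) E; rewrite !comp_lfunE projv_id// => ->.
    exact: memv_proj.
  apply/eqP; rewrite mxof_eq0// subr_eq0; apply/eqP/lfunP => u.
  rewrite !comp_lfunE [RHS]projv_id//; apply: (subvP fU); apply: memv_img.
  exact: memv_proj.
apply/stableE; rewrite -/(end_mx _) -/(rep_mx psi _) -/(rep_curve psi X 1).
have Aq : p *m DD X *m q = 0.
  by have /stableE := HU X Xsu; rewrite PhiE -/(end_mx _) end_mx_induced.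
apply: (@mderiv_linear_ode0 _ _ _ (fun t => p *m rep_curve psi X t *m q) (DD X *m q)).
  move=> t; have [dT _] := one_param_deriv t (one_param_rep psi Xsu) (HDD Xsu).
  apply: mderiv_eq (mderivMr q (mderivMl p dT)) _.
  by apply: mulmx_projections; [rewrite addrC subrK|].
by rewrite /rep_curve su2_exp0 rep_mx1 mulmx1.
Qed.

Lemma induced_comm X Y u : X \in su2C R -> Y \in su2C R ->
  Phi X (Phi Y u) = Phi Y (Phi X u) + Phi (X *m Y - Y *m X) u.
Proof.
move=> XC YC; have [_ br _] := rep_induced_is_induced HDD; rewrite -PhiE in br.
by rewrite (br X Y XC YC) add_lfunE opp_lfunE !comp_lfunE addrC subrK.
Qed.

(** The commutators of the spin operators are the relations required by [sl2_spin_basis];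
    irreducibility passes from the group to these operators by [induced_stable_rep_stable]. *)
Lemma irreducible_spin_basis (s : R) n : 2 * s = n%:R -> \dim {:psi} = n.+1 ->
  irreducible_rep psi ->
  exists e : n.+1.-tuple psi, [/\ basis_of {:psi} e,
    has_matrix e (Phi (S3 R)) (spin_S3 s n.+1),
    has_matrix e (Phi (Splus R)) (spin_Splus s n.+1)
  & has_matrix e (Phi (Sminus R)) (spin_Sminus s n.+1)].
Proof.
move=> sn dV [_ irr]; apply: sl2_spin_basis => //.
- by move=> v; rewrite induced_comm ?S3_su2C ?Splus_su2C// comm_S3_Splus.
- move=> v; rewrite induced_comm ?S3_su2C ?Sminus_su2C// comm_S3_Sminus.
  by rewrite rep_inducedN opp_lfunE.
- move=> v; rewrite induced_comm ?Splus_su2C ?Sminus_su2C// comm_Splus_Sminus.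
  congr (_ + _); apply: etrans (scale_lfunE _ _ _).
  exact: (congr1 (fun f : 'End(psi) => f v) (rep_inducedZ 2 (S3 R))).
move=> U U0 H3 Hp Hm.
have [|//|//] := irr U.
by apply: induced_stable_rep_stable; exact: rep_induced_stable_su2.
Qed.

End Irreducible.

(** * Linear maps defined on bases, and intertwiners *)

Section BasisMap.
Context {K : fieldType} {V W : vectType K} (n : nat).

Definition basis_map_fun (e : n.-tuple V) (f : n.-tuple W) (v : V) : W :=
  \sum_(i < n) coord e i v *: tnth f i.

Lemma basis_map_fun_linear e f : linear (basis_map_fun e f).
Proof.
move=> a u v; rewrite /basis_map_fun scaler_sumr -big_split /=.
by apply: eq_bigr => i _; rewrite linearP scalerDl scalerA.
Qed.

HB.instance Definition _ e f := GRing.isLinear.Build K V W _ (basis_map_fun e f)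
  (basis_map_fun_linear e f).

Definition basis_map e f : 'Hom(V, W) := linfun (basis_map_fun e f).

Lemma basis_mapE (e : n.-tuple V) (f : n.-tuple W) i :
  basis_of {:V} e -> basis_map e f (tnth e i) = tnth f i.
Proof.
move=> eB; rewrite lfunE /= /basis_map_fun (bigD1 i)//= big1 ?addr0.
  by rewrite (tnth_nth 0) coord_free ?(basis_free eB)// eqxx scale1r.
move=> j /negPf ji; rewrite (tnth_nth 0) coord_free ?(basis_free eB)//.
by rewrite -val_eqE /= eq_sym val_eqE ji scale0r.
Qed.

Lemma lfun_basis_eq (e : n.-tuple V) (g h : 'Hom(V, W)) : basis_of {:V} e ->
  (forall i, g (tnth e i) = h (tnth e i)) -> g = h.
Proof.
move=> eB gh; apply/lfunP => v; rewrite (coord_basis eB (memvf v)) !linear_sum.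
apply: eq_bigr => i _; rewrite !linearZ; congr (_ *: _).
by have := gh i; rewrite !(tnth_nth 0).
Qed.

End BasisMap.

Lemma basis_mapK (K : fieldType) (V W : vectType K) n (e : n.-tuple V) (f : n.-tuple W) :
  basis_of {:V} e -> basis_of {:W} f -> cancel (basis_map e f) (basis_map f e).
Proof.
move=> eB fB v; rewrite -comp_lfunE.
have -> : (basis_map f e \o basis_map e f = \1)%VF; last by rewrite lfunE.
by apply: (lfun_basis_eq eB) => i; rewrite comp_lfunE !basis_mapE// lfunE.
Qed.

Lemma has_matrix_intertwine (R : realType) (V W : vectType R[i]) n (e : n.-tuple V)
    (f : n.-tuple W) g h M : basis_of {:V} e -> basis_of {:W} f ->
  has_matrix e g M -> has_matrix f h M ->
  (basis_map e f \o g = h \o basis_map e f)%VF.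
Proof.
move=> eB fB eM fM; apply: (lfun_basis_eq eB) => j.
rewrite !comp_lfunE basis_mapE// eM fM linear_sum; apply: eq_bigr => i _.
by rewrite linearZ /= basis_mapE.
Qed.

(** The map matching the two bases intertwines the three generators, hence all of su(2) by
    linearity, hence the one-parameter groups, whose values at time 1 fill SU(2). *)
Lemma spin_basis_isomorphic (R : realType) (psi phi : SU2_rep R) n (e : n.-tuple psi)
    (f : n.-tuple phi) (DD : {linear 'M[R[i]]_2 -> 'M[R[i]]_(\dim {:psi})})
    (DD' : {linear 'M[R[i]]_2 -> 'M[R[i]]_(\dim {:phi})}) Phi Phi' M3 Mp Mm :
  Phi = rep_induced DD -> Phi' = rep_induced DD' ->
  (forall X, su2 X -> mderiv (rep_curve psi X) 0 (DD X)) ->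
  (forall X, su2 X -> mderiv (rep_curve phi X) 0 (DD' X)) ->
  basis_of {:psi} e -> basis_of {:phi} f ->
  has_matrix e (Phi (S3 R)) M3 -> has_matrix f (Phi' (S3 R)) M3 ->
  has_matrix e (Phi (Splus R)) Mp -> has_matrix f (Phi' (Splus R)) Mp ->
  has_matrix e (Phi (Sminus R)) Mm -> has_matrix f (Phi' (Sminus R)) Mm ->
  isomorphic_rep psi phi.
Proof.
move=> PE PE' HD HD' eB fB e3 f3 ep fp em fm.
pose T := basis_map e f; exists T; split.
  by exists (basis_map f e); exact: basis_mapK.
have T3 := has_matrix_intertwine eB fB e3 f3.
have Tp := has_matrix_intertwine eB fB ep fp.
have Tm := has_matrix_intertwine eB fB em fm.
pose P (X : 'M[R[i]]_2) := (T \o Phi X = Phi' X \o T)%VF.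
have PZ a X : P X -> P (a *: X).
  by rewrite /P (rep_inducedZ PE) (rep_inducedZ PE') => PX; rewrite -comp_lfunZr PX comp_lfunZl.
have PD X Y : P X -> P Y -> P (X + Y).
  by rewrite /P (rep_inducedD PE) (rep_inducedD PE') => PX PY;
     rewrite comp_lfunDr PX PY comp_lfunDl.
have P1 : P (X1 R) by rewrite X1_ladder; apply: (PZ); exact: PD.
have P2 : P (X2 R).
  by rewrite X2_ladder; apply: (PZ); apply: (PD) => //; rewrite -scaleN1r; exact: PZ.
have P3 : P (X3 R) by rewrite X3_S3; exact: PZ _ _ T3.
have Psu X : su2 X -> P X.
  move=> [_ trX]; rewrite -(su2_lift_id trX) /su2_lift.
  exact: PD _ _ (PD _ _ (PZ _ _ P1) (PZ _ _ P2)) (PZ _ _ P3).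
move=> g /su2_exp_surj[X Xsu ->].
pose b := vbasis {:psi}; have bB : basis_of {:psi} b := vbasisP _.
pose c := vbasis {:phi}; have cB : basis_of {:phi} c := vbasisP _.
have inj : injective (mxof b c) by exact: can_inj (mxofK bB cB).
have AF : DD X *m mxof b c T = mxof b c T *m DD' X.
  have := congr1 (mxof b c) (Psu X Xsu); rewrite (mxof_comp b c bB) (mxof_comp b c cB).
  by rewrite -!/(end_mx _) PE PE' !end_mx_induced.
apply: inj; rewrite (mxof_comp b c bB) (mxof_comp b c cB).
exact: (one_param_intertwine 1 (one_param_rep psi Xsu) (one_param_rep phi Xsu)
         (HD X Xsu) (HD' X Xsu) AF).
Qed.

(** * Binary forms *)

Section BinaryForms.
Context {K : fieldType}.

(** A binary form of degree m is stored as the polynomial obtained at y = 1; [hom_eval] restores the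
    powers of y. *)
Definition hom_eval m (p : {poly K}) (x y : K) := \sum_(j < m.+1) p`_j * x ^+ j * y ^+ (m - j).

Lemma hom_eval_linM m a b (p : {poly K}) x y : (size p <= m.+1)%N ->
  hom_eval m.+1 ((a *: 'X + b%:P) * p) x y = (a * x + b * y) * hom_eval m p x y.
Proof.
move=> sp; rewrite /hom_eval.
have E j : ((a *: 'X + b%:P) * p)`_j = a * (if j is i.+1 then p`_i else 0) + b * p`_j.
  by rewrite mulrDl -scalerAl coefD coefZ coefXM coefCM; case: j.
under eq_bigr do rewrite E 2!mulrDl.
rewrite big_split /= big_ord_recl /= mulr0 !mul0r add0r.
rewrite [X in _ + X]big_ord_recr /= nth_default// mulr0 !mul0r addr0.
rewrite mulrDl !mulr_sumr; congr (_ + _); apply: eq_bigr => j _.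
  by rewrite /bump /= add1n subSS exprS; ring.
by rewrite subSn ?exprS -1?ltnS//; ring.
Qed.

Lemma size_linX (a b : K) (p : {poly K}) m : (size p <= m)%N ->
  (size ((a *: 'X + b%:P) * p)%R <= m.+1)%N.
Proof.
move=> sp; apply: leq_trans (size_polyMleq _ _) _.
have s2 : (size (a *: 'X + b%:P)%R <= 2)%N.
  apply: leq_trans (size_polyD _ _) _; rewrite geq_max.
  rewrite (leq_trans (size_scale_leq _ _)) ?size_polyX//=.
  by rewrite (leq_trans (size_polyC_leq1 _)).
by rewrite -subn1 leq_subLR; apply: leq_trans (leq_add s2 sp) _.
Qed.

Definition form_poly n (g : 'M[K]_2) k : {poly K} :=
  (g 0 0 *: 'X + (g 0 1)%:P) ^+ k * (g 1 0 *: 'X + (g 1 1)%:P) ^+ (n - k).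

Lemma form_powers (g : 'M[K]_2) k l x y :
  let p := (g 0 0 *: 'X + (g 0 1)%:P) ^+ k * (g 1 0 *: 'X + (g 1 1)%:P) ^+ l in
  (size p <= (k + l).+1)%N /\
  hom_eval (k + l) p x y =
    (g 0 0 * x + g 0 1 * y) ^+ k * (g 1 0 * x + g 1 1 * y) ^+ l.
Proof.
elim: k => [|k [IH1 IH2]] /=; last first.
  rewrite exprS -mulrA; split; first exact: size_linX.
  by rewrite addSn hom_eval_linM// IH2 exprS mulrA.
rewrite expr0 mul1r add0n; elim: l => [|l [IH1 IH2]].
  by rewrite expr0 size_poly1 /hom_eval big_ord1 coef1 !expr0 !mulr1.
rewrite exprS; split; first exact: size_linX.
by rewrite hom_eval_linM// IH2 !expr0 !mul1r exprS.
Qed.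

Definition form_row n (x y : K) : 'rV[K]_n.+1 := \row_k (x ^+ k * y ^+ (n - k)).

(* Substitution of [(x, y)] by [g (x, y)] in binary forms of degree [n], in the
   basis of monomials [x^k y^(n-k)]. *)
Definition form_mx n (g : 'M[K]_2) : 'M[K]_n.+1 := \matrix_(j, k) (form_poly n g k)`_j.

(** This characterizes [form_mx] by point evaluations, so that its algebraic properties need no
    binomial expansions. *)
Lemma form_mxE n g x y : form_row n x y *m form_mx n g =
  form_row n (g 0 0 * x + g 0 1 * y) (g 1 0 * x + g 1 1 * y).
Proof.
apply/rowP => k; rewrite !mxE.
have [_] := form_powers g k (n - k) x y.
rewrite subnKC -1?ltnS// => <-; apply: eq_bigr => j _.
by rewrite !mxE /form_poly mulrC mulrA.
Qed.

End BinaryForms.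

Section FormRepresentation.
Context {K : numFieldType}.

(** Each column of A - B gives a polynomial of size at most n + 1 that vanishes everywhere, in
    particular at 0, ..., n, so it is zero. *)
Lemma form_row_inj n p (A B : 'M[K]_(n.+1, p)) :
  (forall x, form_row n x 1 *m A = form_row n x 1 *m B) -> A = B.
Proof.
move=> AB; apply/eqP; rewrite -subr_eq0; apply/eqP/matrixP => j k; rewrite mxE.
pose q := \poly_(i < n.+1) (A - B) (inord i) k.
have root_q x : root q x.
  rewrite /root horner_poly; apply/eqP.
  have := congr1 (fun M : 'rV[K]_p => M 0 k) (AB x); rewrite !mxE => /eqP.
  rewrite -subr_eq0 -sumrB => /eqP E; rewrite -[RHS]E; apply: eq_bigr => i _.
  by rewrite inord_val !mxE expr1n mulr1; ring.
have q0 : q = 0.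
  apply/eqP; apply: contraT => q0.
  have := @max_poly_roots _ q [seq i%:R | i <- iota 0 n.+1] q0.
  rewrite size_map size_iota ltnNge size_poly; apply.
    by apply/allP => x _; exact: root_q.
  by rewrite map_inj_uniq ?iota_uniq// => i i' /eqP; rewrite eqr_nat => /eqP.
have := congr1 (fun r : {poly K} => r`_j) q0.
by rewrite coef_poly ltn_ord inord_val coef0 !mxE.
Qed.

Lemma form_mx1 n : form_mx n (1%:M : 'M[K]_2) = 1%:M.
Proof.
apply: form_row_inj => x; rewrite form_mxE mulmx1 !mxE /=.
by rewrite !mul1r !mul0r addr0 add0r.
Qed.

(** Substitution reverses products; so does the action on row vectors by right multiplication, which
    therefore is a homomorphism. *)
Lemma form_mxM n (g h : 'M[K]_2) : form_mx n (g *m h) = form_mx n h *m form_mx n g.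
Proof.
apply: form_row_inj => x; rewrite mulmxA !form_mxE.
have lift01 : lift ord0 ord0 = 1 :> 'I_2 by apply/val_inj.
rewrite !mxE !big_ord_recl !big_ord0 !addr0 !lift01.
by congr form_row; ring.
Qed.

Lemma form_mx_diag n (g : 'M[K]_2) : g 0 1 = 0 -> g 1 0 = 0 ->
  forall j k, form_mx n g j k = (g 0 0 ^+ k * g 1 1 ^+ (n - k)) *+ (j == k).
Proof.
move=> g01 g10 j k; rewrite mxE /form_poly g01 g10 scale0r add0r addr0.
rewrite exprZn -scalerAl -polyC_exp mulrC mul_polyC scalerA coefZ coefXn.
by rewrite -[RHS]mulr_natr.
Qed.

(** The binomial expansion of (g10 x + g11 y)^n. All entries are nonzero in characteristic 0 when
    g10 and g11 are, which is what irreducibility needs. *)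
Lemma form_mx_first_col n (g : 'M[K]_2) (j : 'I_n.+1) :
  form_mx n g j 0 = g 1 0 ^+ j * g 1 1 ^+ (n - j) *+ 'C(n, j).
Proof.
rewrite mxE /form_poly expr0 mul1r subn0 addrC exprDn coef_sum (bigD1 j)//= big1 ?addr0.
  rewrite exprZn -polyC_exp mul_polyC scalerA coefMn coefZ coefXn eqxx mulr1.
  by rewrite [_ * g 1 0 ^+ _]mulrC.
move=> i /negPf ij; rewrite exprZn -polyC_exp mul_polyC scalerA coefMn coefZ coefXn.
by rewrite eq_sym val_eqE ij mulr0 mul0rn.
Qed.

Lemma form_mx_first_row n (g : 'M[K]_2) (k : 'I_n.+1) :
  form_mx n g 0 k = g 0 1 ^+ k * g 1 1 ^+ (n - k).
Proof.
by rewrite mxE /form_poly -horner_coef0 !hornerE.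
Qed.

End FormRepresentation.

Section FormRep.
Context {R : realType} (n : nat).

Definition coef_continuous (P : 'M[R[i]]_2 -> {poly R[i]}) :=
  forall j, continuous (fun g => (P g)`_j).

Lemma coef_continuousM P Q : coef_continuous P -> coef_continuous Q ->
  coef_continuous (fun g => P g * Q g).
Proof.
move=> cP cQ j; rewrite (_ : (fun g => _) =
    \sum_(i < j.+1) (fun g => (P g)`_i * (Q g)`_(j - i))); last first.
  by apply/funext => g; rewrite coefM fct_sumE.
elim/big_ind: _ => [|f1 f2 c1 c2|i _ g]; first exact: cst_continuous.
  by move=> g; apply: continuousD; [exact: c1|exact: c2].
exact: (@cvgM _ _ (nbhs g) _ _ _ _ _ (cP i g) (cQ (j - i)%N g)).
Qed.

Lemma coef_continuousX P k : coef_continuous P -> coef_continuous (fun g => P g ^+ k).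
Proof.
move=> cP; elim: k => [|k IH].
  by move=> j; rewrite (_ : (fun g => _) = fun=> (1 : {poly R[i]})`_j)//; exact: cst_continuous.
rewrite (_ : (fun g => _) = fun g => P g * P g ^+ k).
  exact: coef_continuousM.
by apply/funext => g; rewrite exprS.
Qed.

Lemma coef_continuous_linear (i : 'I_2) :
  coef_continuous (fun g => g i 0 *: 'X + (g i 1)%:P).
Proof.
move=> j; rewrite (_ : (fun g => _) = fun g : 'M[R[i]]_2 =>
   g i 0 * (j == 1%N)%:R + g i 1 * (j == 0%N)%:R).
  move=> g; have c k := @coord_continuous R[i] 2 2 i k g.
  have d (x : R[i]) : (fun=> x) @ nbhs g --> x by exact: cvg_cst.
  exact: (@cvgD _ _ _ (nbhs g) _ _ _ _ _
    (@cvgM _ _ (nbhs g) _ _ _ _ _ (c 0) (d _)) (@cvgM _ _ (nbhs g) _ _ _ _ _ (c 1) (d _))).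
apply/funext => g; rewrite coefD coefZ coefX coefC.
by case: (j == 0%N); rewrite ?mulr1 ?mulr0.
Qed.

Lemma form_mx_continuous (g : 'M[R[i]]_2) e : 0 < e ->
  \forall h \near g, mnorm (form_mx n h - form_mx n g) < e.
Proof.
move=> e0; pose k : R := (n.+1 * n.+1).+1%:R; have k0 : 0 < k by rewrite ltr0n.
have H : \forall h \near g, forall jk : 'I_n.+1 * 'I_n.+1,
    normc (form_mx n h jk.1 jk.2 - form_mx n g jk.1 jk.2) <= e / k.
  apply: (@filter_forall _ _ (fun (jk : 'I_n.+1 * 'I_n.+1) (h : 'M[R[i]]_2) =>
    normc (form_mx n h jk.1 jk.2 - form_mx n g jk.1 jk.2) <= e / k) (nbhs g) _ _).
  move=> [j l] /=.
  have : coef_continuous (fun h => form_poly n h l).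
    by apply: coef_continuousM; apply: coef_continuousX; exact: coef_continuous_linear.
  move=> /(_ j g) /cvgrPdist_le /(_ (e / k)%:C).
  rewrite ltcR divr_gt0// => /(_ isT); apply: filterS => h.
  by rewrite normr_normc lecR !mxE -normc_opp opprB.
apply: filterS H => h H; apply: (@le_lt_trans _ _ (\sum_(i < n.+1) \sum_(j < n.+1) e / k)).
  by apply: ler_sum => i _; apply: ler_sum => j _; have := H (i, j); rewrite !mxE.
rewrite !sumr_const !card_ord -mulrnA -mulr_natr mulrAC ltr_pdivrMr//.
by rewrite ltr_pM2l// ltr_nat.
Qed.

Definition form_fun (g : 'M[R[i]]_2) : 'End('rV[R[i]]_n.+1) := linfun (mulmxr (form_mx n g)).

Lemma form_funE g v : form_fun g v = v *m form_mx n g.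
Proof. by rewrite lfunE. Qed.

Lemma form_fun1 : form_fun 1%:M = \1%VF.
Proof. by apply/lfunP => v; rewrite form_funE form_mx1 mulmx1 lfunE. Qed.

Lemma form_funM g h : SU2 g -> SU2 h -> form_fun (g *m h) = (form_fun g \o form_fun h)%VF.
Proof.
move=> _ _; apply/lfunP => v.
rewrite comp_lfunE; apply: etrans (form_funE _ _) _.
rewrite form_mxM mulmxA; apply/esym; apply: etrans (form_funE _ _) _.
by congr (_ *m _); exact: form_funE.
Qed.

(** [end_mx] refers to the basis [vbasis], not to the monomials; the passage from [form_mx] to it is
    a linear map, hence bounded. *)
Lemma form_fun_continuous :
  {within (@SU2 R), continuous (fun g => end_mx (form_fun g))}.
Proof.
apply: continuous_subspaceT => g B /nbhs_mnormP[d d0 dB].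
pose b := vbasis {:'rV[R[i]]_n.+1}.
pose L (A : 'M[R[i]]_n.+1) : 'M[R[i]]_(\dim {:'rV[R[i]]_n.+1}) := mxof b b (linfun (mulmxr A)).
have L_lin : linear L.
  move=> a A1 A2; rewrite /L -linearP; congr (mxof b b _).
  apply/lfunP => v; rewrite add_lfunE scale_lfunE !lfunE /=.
  by rewrite mulmxDr scalemxAr.
pose aux := GRing.isLinear.Build R[i] 'M[R[i]]_n.+1 'M[R[i]]_(\dim {:'rV[R[i]]_n.+1}) _ L L_lin.
pose LL : {linear 'M[R[i]]_n.+1 -> 'M[R[i]]_(\dim {:'rV[R[i]]_n.+1})} := HB.pack L aux.
have [C C0 LC] := mnorm_linear_bound LL.
have := form_mx_continuous g (divr_gt0 d0 C0); apply: filterS => h Hh; apply: dB.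
have E k : end_mx (form_fun k) = LL (form_mx n k) by [].
by rewrite (E h) (E g) -linearB; apply: le_lt_trans (LC _) _; rewrite -ltr_pdivlMl// mulrC.
Qed.

Definition form_rep : SU2_rep R := SU2Rep form_fun1 form_funM form_fun_continuous.

Lemma dim_form_rep : \dim {:form_rep} = n.+1.
Proof. by rewrite dimvf /dim /= mul1n. Qed.

Lemma expc_cos_sin (x : R) k : (cos x +i* sin x) ^+ k = cos (x *+ k) +i* sin (x *+ k).
Proof.
elim: k => [|k IH]; first by rewrite expr0 mulr0n cos0 sin0.
rewrite exprS IH mulrS cosD sinD; apply: complex_eq; rewrite !cReImE /=; ring.
Qed.

(** For a = exp(i th) the numbers are exp(i (2k - n) th), and th = pi / (2 (n + 1)) is small enough
    to keep them apart. *)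
Lemma torus_element : exists a : R[i], a * conjc a = 1 /\
  {in gtn n.+1 &, injective (fun k => a ^+ k * conjc a ^+ (n - k))}.
Proof.
pose th : R := pi / (2 * n.+1%:R); exists (cos th +i* sin th).
have aa : (cos th +i* sin th) * conjc (cos th +i* sin th) = 1.
  apply: complex_eq; rewrite !cReImE /=; last by ring.
  by rewrite -(cos2Dsin2 th); ring.
split=> // j k jn kn E.
set a := _ +i* _ in aa E; rewrite !inE !ltnS in jn kn.
(* Multiplication by a^n leaves a^(2l), whose angle lies in [0, pi], where the cosine is
   injective. *)
have sq l : (l <= n)%N -> a ^+ n * (a ^+ l * conjc a ^+ (n - l)) = a ^+ (l + l).
  move=> ln; rewrite -{1}(subnK ln) exprD.
  transitivity (a ^+ l * a ^+ l * (a * conjc a) ^+ (n - l)).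
    by rewrite exprMn; ring.
  by rewrite aa expr1n mulr1 exprD.
have th0 : th != 0 by rewrite mulf_neq0 ?invr_eq0 ?mulf_neq0 ?pnatr_eq0// gt_eqF ?pi_gt0.
have : a ^+ (j + j) = a ^+ (k + k) by rewrite -!sq// E.
rewrite !expc_cos_sin => /(congr1 (@complex.Re R)) /=.
have inpi l : (l <= n)%N -> th *+ (l + l) \in `[0, pi].
  move=> ln; rewrite in_itv /= -mulr_natr mulr_ge0 ?divr_ge0 ?pi_ge0//=.
  rewrite /th -mulrA ler_piMr ?pi_ge0// mulrC ler_pdivrMr ?mulr_gt0// mul1r.
  by rewrite addnn -mul2n natrM ler_pM2l// ler_nat ltnW.
move=> /cos_inj; rewrite !inpi// => /(_ isT isT).
rewrite -![th *+ _]mulr_natr => /(mulfI th0)/eqP.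
by rewrite eqr_nat !addnn => /eqP/double_inj.
Qed.

Lemma form_rep_irreducible : irreducible_rep form_rep.
Proof.
split=> [V0|U stabU].
  have := dim_form_rep; rewrite V0 dimv0//.
have [->|U0] := eqVneq U 0%VS; first by left.
right; have stab g v : SU2 g -> v \in U -> v *m form_mx n g \in U.
  by move=> gS vU; rewrite -form_funE; apply: (subvP (stabU g gS)); exact: memv_img.
have [a [aa a_inj]] := torus_element.
pose t k := a ^+ k * conjc a ^+ (n - k).
have gS : SU2 (mx22 a 0 0 (conjc a)).
  apply/SU2P; exists a, 0; split; last by rewrite mul0r addr0.
  by congr mx22; rewrite rmorph0 oppr0.
have tE (v : 'rV_n.+1) k : (v *m form_mx n (mx22 a 0 0 (conjc a))) 0 k = v 0 k * t k.
  rewrite mxE (bigD1 k)//= big1 ?addr0.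
    by rewrite form_mx_diag ?mx22E// eqxx.
  by move=> i /negPf ik; rewrite form_mx_diag ?mx22E// ik mulr0n mulr0.
(* The coordinates in [s] are killed one at a time: applying the diagonal element and subtracting
   t_i times the vector multiplies the k-th coordinate by t_k - t_i. *)
have sep (j : 'I_n.+1) (s : seq 'I_n.+1) (v : 'rV[R[i]]_n.+1) :
    j \notin s -> v \in U -> v 0 j != 0 ->
    exists w : 'rV[R[i]]_n.+1, [/\ w \in U, w 0 j != 0 & forall i, i \in s -> w 0 i = 0].
  elim: s => [|i s IH] js vU vj; first by exists v.
  move: js; rewrite inE negb_or => /andP[ji js].
  have [w [wU wj ws]] := IH js vU vj.
  exists (w *m form_mx n (mx22 a 0 0 (conjc a)) - t i *: w).
  have E k : (w *m form_mx n (mx22 a 0 0 (conjc a)) - t i *: w) 0 k = (t k - t i) * w 0 k.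
    have := tE w k; move: (w *m _) => y yE.
    by rewrite !mxE yE mulrBl [t k * _]mulrC.
  split.
  - by rewrite memvB ?memvZ// stab.
  - rewrite E mulf_neq0// subr_eq0; apply: contraNneq ji => /a_inj.
    by rewrite !inE !ltn_ord => /(_ isT isT)/val_inj ->.
  move=> k; rewrite E inE => /orP[/eqP ->|ks]; first by rewrite subrr mul0r.
  by rewrite ws// mulr0.
have delta (v : 'rV[R[i]]_n.+1) j : v \in U -> v 0 j != 0 -> delta_mx 0 j \in U.
  move=> vU vj; have js : j \notin [seq i <- enum 'I_n.+1 | i != j].
    by rewrite mem_filter eqxx.
  have [w [wU wj ws]] := sep j _ v js vU vj.
  have -> : delta_mx 0 j = (w 0 j)^-1 *: w.
    apply/rowP => i; rewrite !mxE eqxx /=; case: eqP => [->|/eqP ij].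
      by rewrite mulVf.
    have -> : w 0 i = 0 by apply: ws; rewrite mem_filter ij mem_enum.
    by rewrite mulr0.
  exact: memvZ.
(* The triple 3, 4, 5 gives a rotation with all entries nonzero. *)
pose c : R[i] := (4%:R / 5%:R)%:C; pose d : R[i] := (3%:R / 5%:R)%:C.
have rS : SU2 (mx22 c d (- d) c).
  apply/SU2P; exists c, d; split; first by rewrite /c /d !conjc_real.
  by rewrite /c /d !conjc_real; apply: complex_eq; rewrite !cReImE /=; field.
have c0 : c != 0 by rewrite (inj_eq (@complexI R)) mulf_neq0 ?invr_eq0 ?pnatr_eq0.
have d0 : d != 0 by rewrite (inj_eq (@complexI R)) mulf_neq0 ?invr_eq0 ?pnatr_eq0.
have deltaE (j k : 'I_n.+1) (A : 'M[R[i]]_n.+1) : ((delta_mx 0 j : 'rV_n.+1) *m A) 0 k = A j k.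
  by rewrite -rowE mxE.
have [u uU [j uj]] : exists2 u : 'rV[R[i]]_n.+1, u \in U & exists j, u 0 j != 0.
  exists (vpick U); first exact: memv_pick.
  apply: contrapT => nz; move: U0; rewrite -vpick0 => /negP; apply; apply/eqP/rowP => j.
  rewrite mxE; apply/eqP; apply: contraT => uj; case: nz; by exists j.
(* The rotation sends any monomial to a form with nonzero coordinate 0, and then the monomial of
   index 0 to a form with all coordinates nonzero. *)
have e0 : delta_mx 0 0 \in U.
  apply: (delta (delta_mx 0 j *m form_mx n (mx22 c d (- d) c))).
    by apply: stab => //; exact: delta uj.
  rewrite deltaE form_mx_first_col !mx22E -mulr_natr !mulf_neq0 ?expf_neq0 ?oppr_eq0//.
  by rewrite pnatr_eq0 -lt0n bin_gt0 -ltnS.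
have ek k : delta_mx 0 k \in U.
  apply: (delta (delta_mx 0 0 *m form_mx n (mx22 c d (- d) c))); first exact: stab.
  by rewrite deltaE form_mx_first_row !mx22E mulf_neq0 ?expf_neq0.
apply/vspaceP => v; rewrite memvf (row_sum_delta v).
by apply: memv_suml => k _; apply: memvZ.
Qed.

End FormRep.

Theorem theorem2p3 (R : realType) (s : R) (n : nat) (hs : 2 * s = n%:R) :
  exists phi : SU2_rep R,
    [/\ irreducible_rep phi,
        \dim {:phi} = n.+1,
        (forall psi : SU2_rep R,
           irreducible_rep psi -> \dim {:psi} = n.+1 -> isomorphic_rep psi phi)
      & exists (Phi : 'M[R[i]]_2 -> 'End(phi)) (e : n.+1.-tuple phi),
          [/\ is_induced_rep Phi,
              basis_of {:phi} e,
              has_matrix e (Phi (S3 R)) (spin_S3 s n.+1),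
              has_matrix e (Phi (Splus R)) (spin_Splus s n.+1)
            & has_matrix e (Phi (Sminus R)) (spin_Sminus s n.+1)]].
Proof.
(* The explicit model is forgotten here: only irreducibility and dimension matter, and the same
   lemma then serves [phi] and any competitor [psi]. *)
have [phi [irr dim_phi]] : exists phi : SU2_rep R, irreducible_rep phi /\ \dim {:phi} = n.+1.
  by exists (@form_rep R n); split; [exact: form_rep_irreducible|exact: dim_form_rep].
have [DD HDD] := rep_differential_exists phi.
have [e [eB e3 ep em]] := irreducible_spin_basis HDD erefl hs dim_phi irr.
exists phi; split=> // [psi psi_irr dim_psi|].
  have [DD' HDD'] := rep_differential_exists psi.
  have [f [fB f3 fp fm]] := irreducible_spin_basis HDD' erefl hs dim_psi psi_irr.
  exact: (spin_basis_isomorphic erefl erefl HDD' HDD fB eB f3 e3 fp ep fm em).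
by exists (rep_induced DD), e; split=> //; exact: rep_induced_is_induced.
Qed.
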